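(* Let $d\geq 2$ be an integer and let $G$ be a finite simple graph embedded in a surface of Euler characteristic $\varepsilon>0$. If $\Delta(G)\geq 5d+2$, then $C_{d,1}^T(G)\leq \Delta(G)+2d$.
   Context: $\Delta(G)$ is the maximum degree of $G$. A $(d,1)$-total labelling of $G$ is an assignment $c$ of integer labels (colors) to the elements of $V(G)\cup E(G)$ such that $c(u)\neq c(v)$ whenever $uv\in E(G)$, $c(e)\neq c(e')$ whenever $e,e'$ are distinct edges sharing an endpoint, and $|c(u)-c(e)|\geq d$ whenever vertex $u$ is incident with edge $e$. Given a list $L(x)$ of integers for each $x\in V(G)\cup E(G)$, an $L$-$(d,1)$-total labelling is a $(d,1)$-total labelling $c$ with $c(x)\in L(x)$ for all $x$. $G$ is $k$-$(d,1)$-total choosable if it has an $L$-$(d,1)$-total labelling for every list assignment $L$ with $|L(x)|=k$ for all $x\in V(G)\cup E(G)$. The $(d,1)$-total choosability $C_{d,1}^T(G)$ is the minimum $k$ such that $G$ is $k$-$(d,1)$-total choosable. *)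

(* Defs.v *)
From HB Require Import structures.
From mathcomp Require Import all_boot all_order all_algebra finmap.
From mathcomp Require Import all_classical all_reals all_analysis.

Set Implicit Arguments.
Unset Strict Implicit.
Unset Printing Implicit Defensive.

Import Order.TTheory GRing.Theory Num.Theory.
Import numFieldNormedType.Exports.

Local Open Scope ring_scope.

Record sgraph := SGraph {
  vertex :> finType;
  adj : rel vertex;
  adj_sym : symmetric adj;
  adj_irr : irreflexive adj }.

Definition edge_set (G : sgraph) : {set {set G}} :=
  [set [set p.1; p.2]%SET | p in [pred p : G * G | adj p.1 p.2]]%SET.

Definition edge (G : sgraph) := {A : {set G} | A \in edge_set G}.

Definition max_degree (G : sgraph) : nat :=
  (\max_(v : G) #|[pred w | adj v w]|)%N.

Definition element (G : sgraph) : finType := (G + edge G)%type.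

Definition total_labelling (d : nat) (G : sgraph) (c : element G -> int) : Prop :=
  [/\ forall u v : G, adj u v -> c (inl u) <> c (inl v),
      forall e e' : edge G, e != e' ->
        (val e :&: val e' != finset.set0)%SET -> c (inr e) <> c (inr e')
    & forall (u : G) (e : edge G), u \in val e ->
        d%:Z <= `|c (inl u) - c (inr e)|].

Definition total_choosable (d : nat) (G : sgraph) (k : nat) : Prop :=
  forall L : element G -> {fset int}, (forall x, #|` L x| = k) ->
  exists2 c : element G -> int, total_labelling d c & forall x, c x \in L x.

Lemma total_choosable_ex (d : nat) (G : sgraph) :
  exists k, `[< total_choosable d G k >].
Proof.
exists (#|element G| * d.*2.+1).+1; apply/asboolP => L Lk.
suff greedy (s : seq (element G)) : (size s <= #|element G|)%N -> uniq s ->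
    exists c : element G -> int, (forall x, x \in s -> c x \in L x) /\
      (forall x y, x \in s -> y \in s -> x != y -> d%:Z < `|c x - c y|).
  have [|c [cL cd]] := greedy (enum (element G)) _ (enum_uniq _).
    by rewrite -cardE.
  have far x y : x != y -> d%:Z < `|c x - c y|.
    by move=> xy; apply: cd; rewrite ?mem_enum.
  have neq x y : x != y -> c x <> c y.
    by move=> /far + cxy; rewrite cxy subrr normr0.
  exists c => [|x]; last by apply: cL; rewrite mem_enum.
  split=> [u v uv|e e' ee' _|u e _].
  - apply: neq; apply/eqP => -[uv']; move: uv.
    by rewrite uv' adj_irr.
  - by apply: neq; apply/eqP => -[eE]; rewrite eE eqxx in ee'.
  - by apply: ltW; apply: far.
elim: s => [|x s IHs]; first by move=> _ _; exists (fun=> 0).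
move=> /= szs /andP[xs us]; have [c [cL cd]] := IHs (ltnW szs) us.
pose bad := [seq c y + i%:Z - d%:Z | y <- s, i <- iota 0 d.*2.+1].
have [a aL abad] : exists2 a, a \in L x & a \notin bad.
  apply: contrapT => noa.
  have sub : {subset (L x : seq int) <= bad}.
    by move=> a aL; apply/negPn/negP => abad; apply: noa; exists a.
  have := uniq_leq_size (fset_uniq (L x)) sub.
  rewrite size_allpairs size_iota => /leq_trans/(_ (leq_mul (ltnW szs) (leqnn _))).
  by rewrite [X in (X <= _)%N](Lk x) ltnn.
have afar y : y \in s -> d%:Z < `|a - c y|.
  move=> ys; rewrite ltNge; apply/negP; rewrite ler_norml => /andP[la ua].
  move/negP: abad; apply; apply/allpairsP.
  have nn : 0 <= a - c y + d%:Z by rewrite -lerBlDr sub0r.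
  exists (y, absz (a - c y + d%:Z)); split=> //.
    rewrite mem_iota leq0n add0n ltnS andTb -lez_nat gez0_abs //.
    by rewrite -addnn PoszD lerD2r.
  by rewrite /= gez0_abs // addrA addrK addrC subrK.
exists (fun y => if y == x then a else c y); split=> [y|y z].
  by rewrite inE; case: eqP => [->|_ /= /cL].
rewrite !inE; case: eqP => [->|_]; case: eqP => [->|_] /=.
- by rewrite eqxx.
- by move=> _ /afar.
- by move=> /afar; rewrite distrC.
- exact: cd.
Qed.

Definition total_choosability (d : nat) (G : sgraph) : nat :=
  ex_minn (total_choosable_ex d G).

Section Complexes.
Variables (n : nat) (K : {set {set 'I_n}}).
Local Open Scope set_scope.

Definition simplicial_complex : Prop :=
  [/\ finset.set0 \notin K, forall v, [set v] \in K
    & forall s t : {set 'I_n}, s != finset.set0 -> s \subset t -> t \in K -> s \in K].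

(* Adjacency in the link of v, a graph on the neighbours of v. *)
Definition link_adj (v : 'I_n) : rel 'I_n :=
  [rel w w' | (#|[set v; w; w']| == 3%N) && ([set v; w; w'] \in K)].

(* A connected pure 2-dimensional complex in which every edge lies on exactly
   two triangles and every vertex link is connected, hence a cycle: the
   triangulations of connected closed surfaces, with vertex set 'I_n. *)
Definition closed_surface_complex : Prop :=
  [/\ simplicial_complex,
      forall s, s \in K -> exists t, [/\ t \in K, #|t| = 3%N & s \subset t],
      forall s, s \in K -> #|s| = 2%N ->
        #|[set t in K | (#|t| == 3%N) && (s \subset t)]| = 2%N,
      forall v w w', w != v -> w' != v -> [set v; w] \in K -> [set v; w'] \in K ->
        connect (link_adj v) w w'
    & forall v w, connect [rel a b | [set a; b] \in K] v w].

Definition complex_euler_char : int := \sum_(s in K) (-1) ^+ #|s|.-1.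

End Complexes.

Local Open Scope classical_set_scope.

(* The geometric realization, in barycentric coordinates. *)
Definition polyhedron (R : realType) (n : nat) (K : {set {set 'I_n}}) :
    set 'rV[R]_n :=
  [set x | [/\ forall i, 0 <= x ord0 i, \sum_i x ord0 i = 1
    & exists2 s, s \in K & forall i, i \notin s -> x ord0 i = 0]].
Arguments polyhedron R {n} K.

Definition homeomorphic (X Y : topologicalType) (A : set X) (B : set Y) : Prop :=
  exists (f : X -> Y) (g : Y -> X),
  [/\ {within A, continuous f} /\ {within B, continuous g},
      set_fun A B f, set_fun B A g,
      forall x, A x -> g (f x) = x & forall y, B y -> f (g y) = y].

Definition closed_surface (R : realType) (S : topologicalType) : Prop :=
  [/\ hausdorff_space S, compact [set: S], connected [set: S], [set: S] !=set0
    & forall p : S, exists (U : set S) (V : set 'rV[R]_2),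
        [/\ open U, U p, open V & homeomorphic U V]].

Definition has_euler_char (R : realType) (S : topologicalType) (eps : int) : Prop :=
  exists (n : nat) (K : {set {set 'I_n}}),
  [/\ closed_surface_complex K, homeomorphic (polyhedron R K) [set: S]
    & complex_euler_char K = eps].

(* Vertices are drawn as the distinct points pos v, and each edge e as the
   simple arc arc e restricted to [0, 1]; values outside [0, 1] are irrelevant. *)
Definition embedding (R : realType) (S : topologicalType) (G : sgraph)
    (pos : G -> S) (arc : edge G -> R -> S) : Prop :=
  [/\ injective pos,
      forall e : edge G,
        {within `[0, 1], continuous (arc e)} /\ set_inj `[0, 1] (arc e),
      forall e : edge G, exists u v : G,
        [/\ val e = [set u; v]%SET, arc e 0 = pos u & arc e 1 = pos v],
      forall (e : edge G) (t : R) (v : G), `]0, 1[ t -> arc e t <> pos v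
    & forall (e e' : edge G) (t t' : R), e != e' ->
        `]0, 1[ t -> `]0, 1[ t' -> arc e t <> arc e' t'].

Definition embedded_in (R : realType) (G : sgraph) (S : topologicalType) : Prop :=
  exists (pos : G -> S) (arc : edge G -> R -> S), embedding pos arc.

(* Main.v *)
(** A graph with edge set A and vertex set U that is a minor of a triangulated
closed surface T with H^1(T; F_2) of order at most 2 satisfies |A| <= |U| or
|A| + 1 <= |U| + f, where f counts the nonzero boundaries of the classes of
triangles that can be joined without crossing the minor: a cochain on A that is
orthogonal to these boundaries extends to a cocycle of T. The boundaries are
even sets of edges and every edge lies in at most two of them, so |A| <= 3|U| - 3,
and |A| <= 2|U| - 2 if A is bipartite.

Subdividing each triangle of a triangulation of the surface into N^2 triangles,
the two triangles at an edge and the bound on H^1 survive: a cocycle of the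
subdivision has a primitive on each triangle, and the sums of these primitives
along the edges form a cocycle of the triangulation. A closed surface with
positive Euler characteristic has at most one nontrivial class in H^1. The
vertices of the subdivision close to a connected set form a connected set, and
disjoint compact sets stay disjoint when N is large, so cutting every arc of an
embedding into three pieces shows that the graph is a minor of a fine
subdivision. No Jordan curve theorem is needed.

For the labelling, let M be the maximum degree and remove an edge uv from a
smallest graph without a labelling. If deg u <= 3, uncolour u, label uv and then u;
this gives deg u + deg v >= M + 3. If deg u is 4 or 5 and at most three edges at u
have degree sum at least M + 4 - 2d, uncolour u and all edges of smaller degree sum,
relabel u and then these edges. Hence neighbours of 3-vertices have degree M, and a
4-vertex or 5-vertex has four neighbours of degree at least 8 or 7. The bipartite
bound applied to the edges between the vertices of degree at most 3, 4, 5 and those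
of degree at least M, 8, 7 then contradicts the bound on the number of all edges. *)

From mathcomp Require Import all_boot all_order all_algebra finmap boolp.
From mathcomp Require Import zify lra.
Require Import Defs.

Set Implicit Arguments.
Unset Strict Implicit.
Unset Printing Implicit Defensive.

Import Order.TTheory GRing.Theory Num.Theory.
Local Open Scope ring_scope.

(** * Counting *)

Section FiniteSupport.
Variables (I : finType) (V : finZmodType).
Implicit Types (A B Z : {set {ffun I -> V}}) (D : {set I}) (f g : {ffun I -> V}).

Definition supp_in D : {set {ffun I -> V}} := [set f : {ffun I -> V} | support f \subset D].

Lemma supp_inP D f : reflect (forall i, i \notin D -> f i = 0) (f \in supp_in D).
Proof. by rewrite inE; exact: supportP. Qed.

Lemma card_supp_in D : #|supp_in D| = (#|V| ^ #|D|)%N.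
Proof.
rewrite -[RHS](card_pffun_on 0 (mem D) predT); apply: eq_card => f.
rewrite inE; apply/idP/pffun_onP => [fD|[fD _]]; last exact: fD.
by split=> [|y _].
Qed.

Lemma supp_in_zmod_closed D : zmod_closed [in supp_in D].
Proof.
split=> [|f g /supp_inP fD /supp_inP gD]; apply/supp_inP => i iD; first by rewrite ffunE.
by rewrite !ffunE fD ?gD ?subr0.
Qed.

Lemma card_image_ker (J : finType) (h : {ffun I -> V} -> {ffun J -> V}) A :
    zmod_closed [in A] -> {morph h : f g / f - g} ->
  #|A| = (#|h @: A| * #|[set f in A | h f == 0%R]|)%N.
Proof.
move=> [A0 AB] hB; have h0 : h 0 = 0 by rewrite -(subrr 0) hB subrr.
have AD f g : f \in A -> g \in A -> f + g \in A.
  by move=> fA gA; rewrite -[g]opprK AB // -sub0r AB.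
rewrite -sum1_card (partition_big_imset h) /= -sum_nat_const.
apply: eq_bigr => _ /imsetP[f fA ->]; rewrite sum1dep_card -[RHS](card_imset _ (addrI f)).
apply: eq_card => g; rewrite !inE; apply/andP/imsetP => [[gA /eqP hg]|[k]]; last first.
  rewrite inE => /andP[kA /eqP hk] ->; rewrite AD //=.
  by rewrite -[k]opprK hB -[- k]sub0r hB h0 hk !subr0.
by exists (g - f); rewrite ?inE ?AB ?hB ?hg ?subrr //= addrC subrK.
Qed.

Lemma card_le_double Z B :
    (forall f g, f \in Z -> g \in Z -> [|| f \in B, g \in B | f - g \in B]) ->
  (#|Z| <= 2 * #|B|)%N.
Proof.
move=> ZB; have [/subset_leq_card|] := boolP (Z \subset B); first by lia.
case/subsetPn => f fZ fB; rewrite mul2n -addnn -[X in (_ <= _ + X)%N](card_imset _ (subrI f)).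
apply: leq_trans (leq_card_setU _ _); apply/subset_leq_card/subsetP => g gZ.
rewrite inE; move: (ZB _ _ fZ gZ); rewrite (negPf fB) /=.
by case/orP => [->//|fgB]; apply/orP; right; apply/imsetP; exists (f - g); rewrite ?subKr.
Qed.

Lemma double_card_le Z B : zmod_closed [in Z] -> zmod_closed [in B] -> B \subset Z ->
    (#|Z| <= 2 * #|B|)%N ->
  forall f g, f \in Z -> g \in Z -> [|| f \in B, g \in B | f - g \in B].
Proof.
move=> [_ ZB] [B0 BB] /subsetP sBZ cardZ f g fZ gZ; apply: contraLR cardZ.
rewrite !negb_or -ltnNge => /and3P[fB gB fgB].
pose coset (k : {ffun I -> V}) := [set k - b | b : {ffun I -> V} in B].
have card_coset k : #|coset k| = #|B| by rewrite card_imset //; exact: subrI.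
have coset_sub k : k \in Z -> coset k \subset Z.
  by move=> kZ; apply/subsetP => _ /imsetP[b bB ->]; rewrite ZB // sBZ.
have coset_disjoint k l : k - l \notin B -> [disjoint coset k & coset l].
  apply: contraNT => /pred0Pn[_ /andP[/imsetP[b bB ->] /imsetP[c cB]]].
  move/(congr1 (fun x => x + b - l)); rewrite subrK addrAC [l - c]addrC addrK.
  by rewrite [- c + b]addrC => ->; exact: BB.
have sub3 : coset 0 :|: (coset f :|: coset g) \subset Z.
  by rewrite !subUset !coset_sub // sBZ.
apply: leq_trans (subset_leq_card sub3); rewrite cardsU disjoint_setI0.
  rewrite cardsU disjoint_setI0 ?coset_disjoint // !cards0 !card_coset.
  have : (0 < #|B|)%N by apply/card_gt0P; exists 0.
  lia.
by rewrite -setI_eq0 setIUr setU_eq0 !setI_eq0 !(disjoint_sym (coset 0)) !coset_disjoint ?subr0.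
Qed.

Lemma card_supp_in_sum0 D : (0 < #|D|)%N ->
  (#|V| * #|[set f in supp_in D | (\sum_(i in D) f i == 0)%R]| = #|V| ^ #|D|)%N.
Proof.
case/card_gt0P => i0 i0D; rewrite -card_supp_in.
pose total (f : {ffun I -> V}) : {ffun unit -> V} := [ffun=> \sum_(i in D) f i].
have totalB : {morph total : f g / f - g}.
  move=> f g; apply/ffunP => u; rewrite !ffunE -sumrB.
  by apply: eq_bigr => i _; rewrite !ffunE.
rewrite (card_image_ker (supp_in_zmod_closed D) totalB); congr (_ * _)%N.
  rewrite -[LHS](expn1 #|V|) -card_unit -card_ffun -cardsT; apply: eq_card => k.
  rewrite [LHS]inE; apply/esym/imsetP; exists [ffun i => if i == i0 then k tt else 0].
    by apply/supp_inP => i; rewrite ffunE; case: eqVneq => [->|//]; rewrite i0D.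
  apply/ffunP => -[]; rewrite ffunE (bigD1 i0) //= ffunE eqxx big1 ?addr0 //.
  by move=> i /andP[_ /negPf ii0]; rewrite ffunE ii0.
apply: eq_card => f; rewrite !inE; congr (_ && _).
by apply/eqP/eqP => [s|/ffunP/(_ tt)]; [apply/ffunP => u|]; rewrite !ffunE.
Qed.

End FiniteSupport.

Local Notation F2 := 'F_2.

Lemma pchar_F2 : 2%N \in [pchar F2].
Proof. exact: pchar_Fp. Qed.

Lemma card_F2 : #|F2| = 2%N.
Proof. exact: card_Fp. Qed.

Lemma F2_addxx (x : F2) : x + x = 0.
Proof. exact: addrr_pchar2 pchar_F2 x. Qed.

Lemma F2_opp (x : F2) : - x = x.
Proof. exact: oppr_pchar2 pchar_F2 x. Qed.

Lemma F2_natr_eq0 (n : nat) : ((n%:R : F2) == 0) = ~~ odd n.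
Proof. by rewrite -(dvdn_pcharf pchar_F2) dvdn2. Qed.

Lemma F2_mulrn (x : F2) (n : nat) : x *+ n = x *+ odd n.
Proof. by rewrite -[in LHS](odd_double_half n) mulrnDr -addnn mulrnDr F2_addxx addr0. Qed.

Lemma exchange_big_count (S T : finType) (V : nmodType) (A : {set S}) (B : {set T})
    (P : S -> T -> bool) (f : T -> V) :
  \sum_(s in A) \sum_(t in B | P s t) f t = \sum_(t in B) f t *+ #|[set s in A | P s t]|.
Proof.
under eq_bigr do rewrite big_mkcondr.
rewrite exchange_big; apply: eq_bigr => t _.
by rewrite -big_mkcondr sumr_const; congr (_ *+ _); apply: eq_card => s; rewrite inE.
Qed.

Lemma double_count (S T : finType) (A : {set S}) (B : {set T}) (P : S -> T -> bool) :
  (\sum_(s in A) #|[set t in B | P s t]| = \sum_(t in B) #|[set s in A | P s t]|)%N.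
Proof.
under eq_bigr do rewrite -sum1dep_card.
rewrite (exchange_big_dep (mem B)) /= => [|s t _ /andP[] //]; apply: eq_bigr => t tB.
by rewrite sum1dep_card; apply: eq_card => s; rewrite !inE tB.
Qed.

Section Degree.
Variables (T V : finType) (ends : T -> {set V}).
Implicit Types (A : {set T}) (X : {set V}) (v : V).

Definition degree A v := #|[set e in A | v \in ends e]|.

Lemma sum_degree A X : (\sum_(v in X) degree A v = \sum_(e in A) #|ends e :&: X|)%N.
Proof.
rewrite double_count; apply: eq_bigr => e _.
by apply: eq_card => v; rewrite !inE andbC.
Qed.

End Degree.

(** * Cochains of triangulated surfaces *)

Lemma cards3_third (T : finType) (A : {set T}) x y : #|A| = 3%N -> x \in A -> y \in A -> x != y ->
  exists z, [/\ A = [set x; y; z], x != z & y != z].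
Proof.
move=> A3 xA yA xy; have /cards1P[z Az] : #|A :\ x :\ y| == 1%N.
  have := cardsD1 x A; have := cardsD1 y (A :\ x).
  by rewrite !inE xA yA A3 eq_sym xy /=; lia.
have : z \in A :\ x :\ y by rewrite Az inE.
rewrite !inE => /and3P[zy zx zA]; exists z; split; rewrite 1?eq_sym //.
by rewrite -setUA -Az !setD1K // !inE eq_sym xy.
Qed.

Lemma cards3P (T : finType) (A : {set T}) : #|A| = 3%N ->
  exists x y z, [/\ A = [set x; y; z], x != y, y != z & x != z].
Proof.
move=> A3; have /card_gt1P[x [y [xA yA xy]]] : (1 < #|A|)%N by rewrite A3.
have [z [AE xz yz]] := cards3_third A3 xA yA xy.
by exists x, y, z.
Qed.

Lemma big_set3 (T : finType) (R : Type) (idx : R) (op : Monoid.com_law idx) (f : T -> R) x y z :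
    x != y -> y != z -> x != z ->
  \big[op/idx]_(i in [set x; y; z]) f i = op (op (f x) (f y)) (f z).
Proof.
move=> xy yz xz; rewrite -setUA !big_setU1 ?big_set1 ?inE ?negb_or ?xy //.
by rewrite Monoid.mulmA.
Qed.

Section Cochains.
Variables (W : finType) (E F : {set {set W}}).
Implicit Types (f : {ffun W -> F2}) (phi psi : {ffun {set W} -> F2}) (e t : {set W}).

(* E and F are the sets of edges and of triangles of a complex. *)
Record two_sided : Prop := {
  edge_card : forall e, e \in E -> #|e| = 2%N;
  triangle_card : forall t, t \in F -> #|t| = 3%N;
  triangle_edge : forall t e, t \in F -> e \subset t -> #|e| = 2%N -> e \in E;
  edge_triangles : forall e, e \in E -> #|[set t in F | e \subset t]| = 2%N }.

Definition cob0 f : {ffun {set W} -> F2} :=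
  [ffun e : {set W} => if e \in E then \sum_(w in e) f w else 0].
Definition cob1 phi : {ffun {set W} -> F2} :=
  [ffun t : {set W} => if t \in F then \sum_(e in E | e \subset t) phi e else 0].

Definition cocycles := [set phi in supp_in F2 E | cob1 phi == 0].
Definition coboundaries := cob0 @: setT.
Definition H1_card_le2 := (#|cocycles| <= 2 * #|coboundaries|)%N.

Lemma cob0B : {morph cob0 : f g / f - g}.
Proof.
move=> f g; apply/ffunP => e; rewrite !ffunE; case: ifP => _; last by rewrite subr0.
by rewrite -sumrB; apply: eq_bigr => w _; rewrite !ffunE.
Qed.

Lemma cob1B : {morph cob1 : phi psi / phi - psi}.
Proof.
move=> phi psi; apply/ffunP => t; rewrite !ffunE; case: ifP => _; last by rewrite subr0.
by rewrite -sumrB; apply: eq_bigr => e _; rewrite !ffunE.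
Qed.

Lemma cocycles_zmod_closed : zmod_closed [in cocycles].
Proof.
have [supp0 suppB] := supp_in_zmod_closed F2 E.
split=> [|phi psi /setIdP[phiE /eqP phi0] /setIdP[psiE /eqP psi0]]; apply/setIdP; split.
- exact: supp0.
- by rewrite -[X in cob1 X](subrr 0) cob1B subrr.
- exact: suppB.
- by rewrite cob1B phi0 psi0 subrr.
Qed.

Lemma coboundaries_zmod_closed : zmod_closed [in coboundaries].
Proof.
split=> [|_ _ /imsetP[f _ ->] /imsetP[g _ ->]]; last by rewrite -cob0B imset_f.
by rewrite -(subrr (cob0 0)) -cob0B imset_f.
Qed.

Definition dual_adj (D : {set {set W}}) : rel {set W} :=
  [rel t t' | [&& t \in F, t' \in F & [exists e in D, (e \subset t) && (e \subset t')]]].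

Lemma dual_adj_sym D : connect_sym (dual_adj D).
Proof.
apply: sym_connect_sym => t t'; rewrite /dual_adj /= andbCA; do 2 congr (_ && _).
by apply: eq_existsb => e; congr (_ && _); rewrite andbC.
Qed.

Hypothesis EF : two_sided.

Lemma edge_neq x y : [set x; y] \in E -> x != y.
Proof. by move/(edge_card EF); rewrite cards2; case: eqP. Qed.

Lemma edgeP e : e \in E -> exists x y, e = [set x; y].
Proof.
by move=> /(edge_card EF)/eqP/cards2P[x [y [_ ->]]]; exists x, y.
Qed.

Lemma cob0_pair f x y : [set x; y] \in E -> cob0 f [set x; y] = f x + f y.
Proof.
by move=> xyE; rewrite ffunE xyE big_setU1 ?inE ?edge_neq //= big_set1.
Qed.

Lemma cob1E phi t : t \in F -> cob1 phi t = \sum_(w in t) phi (t :\ w).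
Proof.
move=> tF; have t3 := triangle_card EF tF.
have setD_inj : {in t &, injective (fun w => t :\ w)}.
  by move=> x y xt _ /setP/(_ x); rewrite !inE eqxx xt !andbT; case: eqP => // <-.
rewrite ffunE tF -(big_imset phi setD_inj) /=; apply: eq_bigl => e.
apply/andP/imsetP => [[eE et]|[w wt ->]].
  have /cards1P[w ew] : #|t :\: e| == 1%N by rewrite cardsDS // t3 (edge_card EF).
  exists w; last by rewrite -ew setDDr setDv set0U (setIidPr et).
  have : w \in t :\: e by rewrite ew set11.
  by rewrite inE => /andP[].
have sub : t :\ w \subset t by exact: subD1set.
by split=> //; apply: (triangle_edge EF tF sub); have := cardsD1 w t; rewrite wt t3; lia.
Qed.

Lemma cob1_triangle phi x y z : [set x; y; z] \in F -> x != y -> y != z -> x != z ->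
  cob1 phi [set x; y; z] = phi [set x; y] + phi [set y; z] + phi [set x; z].
Proof.
move=> tF xy yz xz; rewrite cob1E // big_set3 //=.
have [yx zy zx] : [/\ y != x, z != y & z != x] by rewrite ![_ == x]eq_sym (eq_sym z).
have [-> -> ->] : [/\ [set x; y; z] :\ z = [set x; y], [set x; y; z] :\ x = [set y; z] &
    [set x; y; z] :\ y = [set x; z]].
  split; apply/setP => w; rewrite !inE.
  - by case: (eqVneq w z) => [->|]; rewrite ?orbF // (negPf zx) (negPf zy).
  - by case: (eqVneq w x) => [->|] //; rewrite (negPf xy) (negPf xz).
  - by case: (eqVneq w y) => [->|]; rewrite ?orbF // (negPf yx) (negPf yz).
by rewrite addrC addrA.
Qed.

Lemma cob1_cob0 f : cob1 (cob0 f) = 0.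
Proof.
apply/ffunP => t; rewrite [RHS]ffunE.
have [tF|tF] := boolP (t \in F); last by rewrite ffunE (negPf tF).
have t3 := triangle_card EF tF; pose S := \sum_(v in t) f v.
rewrite cob1E // (eq_bigr (fun w => S - f w)) => [|w wt].
  by rewrite sumrB sumr_const t3 -/S !mulrS mulr0n addr0 addrA addrK F2_addxx.
have tw : t :\ w \in E.
  apply: (triangle_edge EF tF (subD1set t w)).
  by have := cardsD1 w t; rewrite wt t3; lia.
by rewrite ffunE tw /S [in RHS](big_setD1 w) //= addrAC subrr add0r.
Qed.

Lemma coboundaries_sub : coboundaries \subset cocycles.
Proof.
apply/subsetP => _ /imsetP[f _ ->]; apply/setIdP; rewrite cob1_cob0; split=> //.
by apply/supp_inP => e eE; rewrite ffunE (negPf eE).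
Qed.

Lemma H1_card_le2P : H1_card_le2 <-> forall phi psi, phi \in cocycles -> psi \in cocycles ->
  [|| phi \in coboundaries, psi \in coboundaries | phi - psi \in coboundaries].
Proof.
split; last exact: card_le_double.
exact: double_card_le cocycles_zmod_closed coboundaries_zmod_closed coboundaries_sub.
Qed.

Lemma cob1_indicator e t : e \in E -> t \in F ->
  cob1 [ffun e' => (e' == e)%:R] t = (e \subset t)%:R.
Proof.
move=> eE tF; rewrite ffunE tF big_mkcond /= (bigD1 e) //= ffunE eqxx eE /=.
rewrite big1 ?addr0 => [|e' /negPf e'e]; last by rewrite ffunE e'e if_same.
by case: ifP.
Qed.

Lemma cob1_connect (D : {set {set W}}) t t' : D \subset E -> connect (dual_adj D) t t' ->
  exists2 x, x \in supp_in F2 D & forall s, s \in F -> cob1 x s = (s == t)%:R + (s == t')%:R.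
Proof.
move=> /subsetP DE /connectP[p]; elim: p t => [|u p IHp] t /=.
  move=> _ ->; exists 0; first by have [] := supp_in_zmod_closed F2 D.
  by move=> s sF; rewrite F2_addxx ffunE sF big1 // => e _; rewrite ffunE.
case/andP => /and3P[tF uF /existsP[e /and3P[eD et eu]]] tu_path u_last.
have [x xD cob_x] := IHp _ tu_path u_last.
have [->|tu] := eqVneq t u; first by exists x.
have [_ suppB] := supp_in_zmod_closed F2 D.
exists ([ffun e' => (e' == e)%:R] - x) => [|s sF].
  by apply: suppB xD; apply/supp_inP => e'; rewrite ffunE; case: eqP => [->|//]; rewrite eD.
rewrite cob1B [LHS]ffunE [X in _ + X]ffunE cob1_indicator ?DE // cob_x // F2_opp.
suff -> : (e \subset s)%:R = (s == t)%:R + (s == u)%:R :> F2.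
  by rewrite addrA; congr (_ + _); rewrite -addrA F2_addxx addr0.
have /setP/(_ s) : [set t; u] = [set t in F | e \subset t].
  apply/eqP; rewrite eqEcard (edge_triangles EF) ?DE // cards2 tu andbT.
  by rewrite subUset !sub1set !inE tF uF et eu.
rewrite !inE sF /= => <-.
by have [->|st] := eqVneq s t; rewrite ?(negPf tu) ?addr0 ?add0r.
Qed.

(* The prescribed values are moved to a root of each component of the dual graph,
   where they cancel. *)
Lemma cob1_solve (D : {set {set W}}) (k : {set W} -> F2) : D \subset E ->
    (forall t, t \in F -> \sum_(s in F | connect (dual_adj D) t s) k s = 0) ->
  exists2 x, x \in supp_in F2 D & forall s, s \in F -> cob1 x s = k s.
Proof.
move=> DE k0; pose rt t := fingraph.root (dual_adj D) t.
have [x xD cob_x] := fin_all_exists2 (fun t => cob1_connect DE (connect_root (dual_adj D) t)).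
exists [ffun e => \sum_(t in F) k t * x t e] => [|s sF].
  apply/supp_inP => e eD; rewrite ffunE big1 // => t _.
  by have /supp_inP -> := xD t; rewrite ?mulr0.
have -> : cob1 [ffun e => \sum_(t in F) k t * x t e] s =
    \sum_(t in F) (k t * (s == t)%:R + k t * (s == rt t)%:R).
  rewrite ffunE sF; under eq_bigr do rewrite ffunE.
  rewrite exchange_big; apply: eq_bigr => t _.
  by rewrite -mulrDr -cob_x // ffunE sF mulr_sumr.
rewrite big_split /= (bigD1 s) //= eqxx mulr1 big1 ?addr0; last first.
  by move=> t /andP[_ /negPf]; rewrite eq_sym => ->; rewrite mulr0.
rewrite [X in _ + X](_ : _ = 0) ?addr0 //.
have [rs|rs] := eqVneq (rt s) s; last first.
  rewrite big1 // => t tF; case: eqP => [st|]; rewrite ?mulr0 //.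
  by move: rs; rewrite st /rt root_root ?eqxx //; exact: dual_adj_sym.
rewrite -[RHS](k0 s sF) [RHS]big_mkcondr; apply: eq_bigr => t _.
rewrite -(root_connect (@dual_adj_sym D)) -/(rt s) -/(rt t) rs.
by case: eqP; rewrite ?mulr1 ?mulr0.
Qed.

End Cochains.

(** * Minors of triangulated surfaces *)

Section Connectedness.
Variables (W : finType) (E : {set {set W}}).
Implicit Types (S : {set W}) (x y : W).

Definition adj_in S : rel W := [rel x y | [&& x \in S, y \in S & [set x; y] \in E]].

Definition connected_in S := forall x y, x \in S -> y \in S -> connect (adj_in S) x y.

Lemma adj_in_sym S : connect_sym (adj_in S).
Proof. by apply: sym_connect_sym => x y; rewrite /adj_in /= andbCA setUC. Qed.

Lemma connect_adj_in_sub S S' x y :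
  S \subset S' -> connect (adj_in S) x y -> connect (adj_in S') x y.
Proof.
move=> /subsetP SS; apply: connect_sub => {}x {}y /and3P[xS yS xyE].
by apply: connect1; rewrite /adj_in /= !SS.
Qed.

Lemma connected_in_eq (T : Type) S (f : W -> T) :
    connected_in S -> (forall x y, x \in S -> y \in S -> [set x; y] \in E -> f x = f y) ->
  {in S &, forall x y, f x = f y}.
Proof.
move=> Sconn fE x y xS yS; have /connectP[p] := Sconn x y xS yS.
elim: p x {xS} => [|z p IHp] x /=; first by move=> _ ->.
by case/andP => /and3P[xS zS xzE] pth lst; rewrite (fE x z) // (IHp z).
Qed.

End Connectedness.

(* The graph with edge set A is a minor of the graph (W, E): beta x is the
   vertex whose branch set contains x, if any. *)
Section MinorModel.
Variables (W V : finType) (E : {set {set W}}) (A : {set {set V}}) (beta : W -> option V).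

Definition branch_set v := [set x | beta x == Some v].

Definition realizes (s : {set W}) (e : {set V}) := exists x y u v,
  [/\ s = [set x; y], s \in E, e = [set u; v], beta x = Some u & beta y = Some v].

Definition minor_model :=
  (forall v, connected_in E (branch_set v)) /\
  (forall e, e \in A -> exists s, realizes s e).

End MinorModel.

Definition even_edge_set (V : finType) (B : {set {set V}}) := forall v, ~~ odd (degree id B v).

Section MinorBound.
Variables (W V : finType) (E F : {set {set W}}) (A : {set {set V}}) (U : {set V}).
Variables (beta : W -> option V) (hat : {set V} -> {set W}).
Hypothesis EF : two_sided E F.
Hypothesis H1_small : H1_card_le2 E F.
Hypothesis A_card : forall e, e \in A -> #|e| = 2%N.
Hypothesis A_sub : forall e, e \in A -> e \subset U.
Hypothesis U_neq0 : U != set0.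
Hypothesis branch_conn : forall v, connected_in E (branch_set beta v).
Hypothesis hat_realizes : forall e, e \in A -> realizes E beta (hat e) e.
Implicit Types (e : {set V}) (h s t : {set W}).
Implicit Types (phi : {ffun {set V} -> F2}) (Phi : {ffun {set W} -> F2}).

Definition inner_edges := [set h in E | [exists v, h \subset branch_set beta v]].
Definition crossable := E :\: (inner_edges :|: hat @: A).

(* The classes of triangles that can be joined without crossing the minor. *)
Definition region t := [set s in F | connect (dual_adj F crossable) t s].
Definition region_reps := [set t in F | fingraph.root (dual_adj F crossable) t == t].
Definition region_count t h := #|[set s in region t | h \subset s]|.
Definition face_walk t := [set e in A | odd (region_count t (hat e))].
Definition faces := [set t in region_reps | face_walk t != set0].

Lemma hat_edge e : e \in A -> hat e \in E.
Proof. by move=> /hat_realizes[x [y [u [v []]]]]. Qed.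

Lemma hat_ends e : e \in A -> e = [set v | Some v \in beta @: hat e].
Proof.
move=> /hat_realizes[x [y [u [v [-> _ -> bx By]]]]].
by apply/setP => w; rewrite imsetU1 imset_set1 bx By !inE !(inj_eq Some_inj).
Qed.

Lemma hat_inj : {in A &, injective hat}.
Proof. by move=> e e' eA e'A hee; rewrite (hat_ends eA) (hat_ends e'A) hee. Qed.

Lemma hat_notin_inner e : e \in A -> hat e \notin inner_edges.
Proof.
move=> eA; rewrite inE hat_edge //=; apply/existsPn => w; apply/negP => /subsetP sub.
have : (#|e| <= 1)%N; last by rewrite A_card.
rewrite -(cards1 w); apply/subset_leq_card/subsetP => v.
rewrite (hat_ends eA) !inE => /imsetP[x /sub]; rewrite inE => /eqP -> [->].
by rewrite eqxx.
Qed.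

Lemma region_count_crossable t h : h \in crossable -> ~~ odd (region_count t h).
Proof.
move=> hC; have hE : h \in E by apply: subsetP hC; exact: subsetDl.
have /eqP/cards2P[s [s' [ss' sE]]] := edge_triangles EF hE.
have [[sF hs] [s'F hs']] : (s \in F /\ h \subset s) /\ (s' \in F /\ h \subset s').
  by split; apply/andP; have := set21 s s'; have := set22 s s'; rewrite -sE !inE.
have same : connect (dual_adj F crossable) t s = connect (dual_adj F crossable) t s'.
  apply: (same_connect_r (@dual_adj_sym _ F _)); apply: connect1.
  by rewrite /dual_adj /= sF s'F; apply/existsP; exists h; rewrite hC hs hs'.
have -> : region_count t h = #|[set r in [set s; s'] | connect (dual_adj F crossable) t r]|.
  by apply: eq_card => r; rewrite -sE !inE andbAC.
have [ts|ts] := boolP (connect (dual_adj F crossable) t s').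
  rewrite (_ : [set r in _ | _] = [set s; s']) ?cards2 ?ss' //; apply/setP => r.
  by rewrite !inE andb_idr // => /orP[] /eqP ->; rewrite ?same.
rewrite (_ : [set r in _ | _] = set0) ?cards0 //; apply/setP => r; rewrite !inE.
by apply/andP => -[/orP[] /eqP ->]; rewrite ?same (negPf ts).
Qed.

Lemma sum_cob1_region t Phi : (forall h, h \in inner_edges -> Phi h = 0) ->
  \sum_(s in region t) cob1 E F Phi s = \sum_(e in A) Phi (hat e) *+ region_count t (hat e).
Proof.
move=> Phi0; rewrite (eq_bigr (fun s => \sum_(h in E | h \subset s) Phi h)) => [|s]; last first.
  by rewrite inE ffunE => /andP[->].
rewrite exchange_big_count (big_setID (hat @: A)) /= [X in _ + X]big1 ?addr0 => [|h].
  rewrite (setIidPr _) ?big_imset //; first exact: hat_inj.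
  by apply/subsetP => _ /imsetP[e eA ->]; exact: hat_edge.
rewrite inE => /andP[hA hE]; have [hI|hI] := boolP (h \in inner_edges).
  by rewrite Phi0 // mul0rn.
by rewrite F2_mulrn (negPf (region_count_crossable t _)) // inE in_setU negb_or hI hA hE.
Qed.

Lemma face_walk_even t : even_edge_set (face_walk t).
Proof.
move=> v; rewrite -F2_natr_eq0; pose f : {ffun W -> F2} := [ffun w => (beta w == Some v)%:R].
have f0 h : h \in inner_edges -> cob0 E f h = 0.
  rewrite inE => /andP[hE /existsP[u /subsetP hu]]; have [x [y hxy]] := edgeP EF hE.
  subst h; move: (hu x (set21 _ _)) (hu y (set22 _ _)); rewrite (cob0_pair EF) // !ffunE !inE.
  by move=> /eqP -> /eqP ->; exact: F2_addxx.
have f_hat e : e \in A -> cob0 E f (hat e) = (v \in e)%:R.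
  move=> eA; have [x [y [u [w [he hE eE bx By]]]]] := hat_realizes eA.
  have uw : u != w by have := A_card eA; rewrite eE cards2; case: eqP.
  rewrite {}he in hE *; rewrite (cob0_pair EF) // !ffunE bx By !(inj_eq Some_inj) eE !inE.
  rewrite ![_ == v]eq_sym; case: (eqVneq v u) => [->|_]; last by rewrite add0r.
  by rewrite (negPf uw) addr0.
have := sum_cob1_region t f0; rewrite (cob1_cob0 EF) big1; last first.
  by move=> s _; rewrite ffunE.
move=> /esym sum0.
apply/eqP; rewrite -[RHS]sum0 -sumr_const big_mkcond [RHS]big_mkcond; apply: eq_bigr => e _.
rewrite !inE; case: (boolP (e \in A)) => //= eA; rewrite f_hat // F2_mulrn.
by case: (v \in e); case: (odd _).
Qed.

Lemma dual_adj_face D s t : connect (dual_adj F D) s t -> (s \in F) = (t \in F).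
Proof. by apply: closed_connect => {}s {}t /and3P[-> ->]. Qed.

Lemma sum_region_count h : h \in E -> (\sum_(t in region_reps) region_count t h = 2)%N.
Proof.
move=> hE; rewrite -(edge_triangles EF hE).
transitivity (\sum_(t in region_reps)
    #|[set s in [set s in F | h \subset s] | connect (dual_adj F crossable) t s]|)%N.
  by apply: eq_bigr => t _; apply: eq_card => s; rewrite !inE andbAC.
rewrite double_count -sum1_card; apply: eq_bigr => s /setIdP[sF _].
rewrite -(cards1 (fingraph.root (dual_adj F crossable) s)); apply: eq_card => t.
have sym := @dual_adj_sym _ F crossable.
rewrite !inE sym; apply/andP/eqP => [[/andP[_ /eqP tr] st]|->].
  by rewrite -tr; apply/esym/(fingraph.rootP sym).
by rewrite root_root // connect_root eqxx -(dual_adj_face (connect_root _ s)) sF.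
Qed.

Lemma face_walks_at_edge e : e \in A -> (#|[set t in faces | e \in face_walk t]| <= 2)%N.
Proof.
move=> eA; rewrite -(sum_region_count (hat_edge eA)) -sum1dep_card big_mkcond [leqRHS]big_mkcond.
apply: leq_sum => t _; case: (t \in region_reps) / boolP => tR; last first.
  by rewrite inE (negPf tR).
by case: ifP => // /andP[_]; rewrite inE => /andP[_]; case: region_count.
Qed.

Definition face_sum phi : {ffun {set W} -> F2} :=
  [ffun t : {set W} => if t \in region_reps
    then \sum_(e in A) phi e *+ region_count t (hat e) else 0].

Lemma face_sumB : {morph face_sum : phi psi / phi - psi}.
Proof.
move=> phi psi; apply/ffunP => t; rewrite !ffunE; case: ifP => _; last by rewrite subr0.
by rewrite -sumrB; apply: eq_bigr => e _; rewrite !ffunE mulrnBl.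
Qed.

Lemma face_sum_faces phi : face_sum phi \in supp_in F2 faces.
Proof.
apply/supp_inP => t; rewrite inE ffunE; case: ifP => //= _; rewrite negbK => /eqP walk0.
rewrite big1 // => e eA; have : e \notin face_walk t by rewrite walk0 inE.
by rewrite inE eA F2_mulrn /= => /negPf ->.
Qed.

Lemma sum_face_sum phi : \sum_(t in faces) face_sum phi t = 0.
Proof.
transitivity (\sum_(t in region_reps) face_sum phi t).
  have sub : faces \subset region_reps by apply/subsetP => t /setIdP[].
  rewrite [RHS](big_setID faces) /= (setIidPr sub) [X in _ + X]big1 ?addr0 // => t.
  by rewrite inE => /andP[tN _]; have /supp_inP -> := face_sum_faces phi.
transitivity (\sum_(t in region_reps) \sum_(e in A) phi e *+ region_count t (hat e)).
  by apply: eq_bigr => t tR; rewrite ffunE tR.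
rewrite exchange_big big1 //= => e eA.
by rewrite sumrMnr sum_region_count ?hat_edge // mulr2n F2_addxx.
Qed.

Definition extends Phi phi := [/\ Phi \in cocycles E F,
  forall h, h \in inner_edges -> Phi h = 0 & forall e, e \in A -> Phi (hat e) = phi e].

Lemma extendsB Phi Psi phi psi : extends Phi phi -> extends Psi psi ->
  extends (Phi - Psi) (phi - psi).
Proof.
have [_ cocyclesB] := cocycles_zmod_closed E F.
move=> [PhiZ Phi0 Phi_hat] [PsiZ Psi0 Psi_hat]; split=> [|h hI|e eA]; first exact: cocyclesB.
  by rewrite !ffunE Phi0 // Psi0 // subr0.
by rewrite !ffunE Phi_hat // Psi_hat.
Qed.

Lemma face_sum_eq0_extends phi : face_sum phi = 0 -> exists Phi, extends Phi phi.
Proof.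
move=> phi0; pose push : {ffun {set W} -> F2} := [ffun h => \sum_(e in A | hat e == h) phi e].
have push_hat e : e \in A -> push (hat e) = phi e.
  move=> eA; rewrite ffunE (big_pred1 e) // => e'; apply/andP/eqP => [[e'A /eqP]|->]; last by [].
  exact: hat_inj.
have push0 h : h \notin hat @: A -> push h = 0.
  by move=> hA; rewrite ffunE big1 // => e /andP[eA /eqP he]; rewrite -he imset_f in hA.
clearbody push; have push_inner h : h \in inner_edges -> push h = 0.
  move=> hI; apply: push0; apply: contraL hI => /imsetP[e eA ->]; exact: hat_notin_inner.
have sum_push t : t \in F ->
    \sum_(s in F | connect (dual_adj F crossable) t s) cob1 E F push s = 0.
  have sym := @dual_adj_sym _ F crossable.
  move=> tF; pose r := fingraph.root (dual_adj F crossable) t.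
  have rR : r \in region_reps.
    by rewrite inE -(dual_adj_face (connect_root _ t)) tF (root_root sym) eqxx.
  transitivity (\sum_(s in region r) cob1 E F push s).
    apply: eq_bigl => s; rewrite inE.
    by rewrite (same_connect sym (connect_root _ t)).
  transitivity (face_sum phi r); last by rewrite phi0 ffunE.
  by rewrite sum_cob1_region // ffunE rR; apply: eq_bigr => e eA; rewrite push_hat.
have [x /supp_inP x_supp cob_x] := cob1_solve EF (subsetDl E _ : crossable \subset E) sum_push.
have x0 h : h \in inner_edges :|: hat @: A -> x h = 0.
  by move=> hI; rewrite x_supp // inE hI.
exists (push - x); split=> [|h hI|e eA].
- apply/setIdP; split.
    apply/supp_inP => h hE; rewrite !ffunE x_supp ?subr0; last first.
      by rewrite inE (negPf hE) andbF.
    by apply: push0; apply: contra hE => /imsetP[e eA ->]; exact: hat_edge.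
  rewrite cob1B subr_eq0; apply/eqP/ffunP => t; have [tF|tF] := boolP (t \in F).
    by rewrite cob_x.
  by rewrite !ffunE (negPf tF).
- by rewrite !ffunE push_inner // x0 ?subr0 // inE hI.
- by rewrite !ffunE push_hat // x0 ?subr0 // inE imset_f ?orbT.
Qed.

Lemma extends_coboundary phi Phi : phi \in supp_in F2 A -> extends Phi phi ->
  Phi \in coboundaries E -> phi \in cob0 A @: supp_in F2 U.
Proof.
move=> /supp_inP phiA [_ Phi0 Phi_hat] /imsetP[f _ Phi_f].
have f_const v : {in branch_set beta v &, forall x y, f x = f y}.
  apply: (connected_in_eq (f := f) (@branch_conn v)) => x y xv yv xyE.
  have : Phi [set x; y] = 0.
    by apply: Phi0; rewrite inE xyE; apply/existsP; exists v; rewrite subUset !sub1set xv.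
  rewrite Phi_f (cob0_pair EF) // => /eqP; rewrite addr_eq0 F2_opp => /eqP //.
pose g : {ffun V -> F2} :=
  [ffun v => if v \in U then odflt 0 (omap f [pick x in branch_set beta v]) else 0].
have gE x v : v \in U -> beta x = Some v -> g v = f x.
  move=> vU bx; have xv : x \in branch_set beta v by rewrite inE bx.
  rewrite ffunE vU; case: pickP => [y yv|/(_ x)]; last by rewrite xv.
  exact: f_const yv xv.
apply/imsetP; exists g; first by apply/supp_inP => v vU; rewrite ffunE (negPf vU).
apply/ffunP => e; rewrite ffunE; case: ifPn => [eA|/phiA //].
rewrite -Phi_hat // Phi_f; have [x [y [u [v [he hE eE bx By]]]]] := hat_realizes eA; subst e.
have := A_sub eA; rewrite subUset !sub1set => /andP[uU vU].
have uv : u != v by have := A_card eA; rewrite cards2; case: eqP.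
rewrite {}he in hE *; rewrite (cob0_pair EF) // big_setU1 ?inE // big_set1.
by rewrite (gE x u) ?(gE y v).
Qed.

Lemma card_cuts : (2 * #|cob0 A @: supp_in F2 U| <= 2 ^ #|U|)%N.
Proof.
have U_closed := supp_in_zmod_closed F2 U.
rewrite -[in leqRHS]card_F2 -(card_supp_in F2) (card_image_ker U_closed (cob0B A)).
rewrite mulnC leq_mul2l; apply/orP; right.
pose one : {ffun V -> F2} := [ffun v => (v \in U)%:R].
have neq : 0 != one.
  by have /set0Pn[u uU] := U_neq0; apply/eqP => /ffunP/(_ u); rewrite !ffunE uU.
apply: (@leq_trans #|[set (0 : {ffun V -> F2}); one]|); first by rewrite cards2 neq.
have [supp0 _] := U_closed; have cut0 : cob0 A 0 = 0 by rewrite -(subrr 0) cob0B subrr.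
apply: subset_leq_card; rewrite subUset !sub1set.
apply/andP; split; apply/setIdP; rewrite ?cut0 //.
split; first by apply/supp_inP => v vU; rewrite ffunE (negPf vU).
apply/eqP/ffunP => e; rewrite !ffunE; case: ifP => // eA.
rewrite (eq_bigr (fun=> 1)) => [|v ve]; last by rewrite ffunE (subsetP (A_sub eA)).
by rewrite sumr_const A_card //; exact: F2_addxx.
Qed.

Lemma card_ker_face_sum : (#|[set phi in supp_in F2 A | face_sum phi == 0%R]| <= 2 ^ #|U|)%N.
Proof.
apply: leq_trans card_cuts; apply: card_le_double.
move=> phi psi /setIdP[phiA /eqP phi0] /setIdP[psiA /eqP psi0].
have [Phi extPhi] := face_sum_eq0_extends phi0; have [Psi extPsi] := face_sum_eq0_extends psi0.
have [PhiZ _ _] := extPhi; have [PsiZ _ _] := extPsi.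
have [_ suppB] := supp_in_zmod_closed F2 A.
have := (H1_card_le2P EF).1 H1_small _ _ PhiZ PsiZ.
case/or3P => cob; apply/or3P; [constructor 1|constructor 2|constructor 3].
- exact: extends_coboundary extPhi cob.
- exact: extends_coboundary extPsi cob.
- by apply: extends_coboundary (extendsB extPhi extPsi) cob; exact: suppB.
Qed.

(* Rank-nullity for face_sum: its kernel has dimension at most |U| and, if there
   is a face, its image has dimension at most |faces| - 1. *)
Lemma minor_euler_bound : (#|A| + 1 <= #|faces| + #|U|)%N \/ (#|A| <= #|U|)%N.
Proof.
have := card_image_ker (supp_in_zmod_closed F2 A) face_sumB.
rewrite card_supp_in card_F2; have := card_ker_face_sum.
have im_sub : face_sum @: supp_in F2 A \subset
    [set k in supp_in F2 faces | \sum_(t in faces) k t == 0].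
  apply/subsetP => _ /imsetP[phi _ ->]; apply/setIdP.
  by rewrite face_sum_faces sum_face_sum.
have := subset_leq_card im_sub; have [->|faces_neq0] := eqVneq faces set0.
  move=> im_le ker_le cardA; right; rewrite -(@leq_exp2l 2) // cardA -[leqRHS]mul1n.
  apply: leq_mul ker_le; apply: leq_trans im_le _; rewrite setIdE.
  apply: leq_trans (subset_leq_card (subsetIl _ _)) _.
  by rewrite card_supp_in cards0.
rewrite -card_gt0 in faces_neq0; have := card_supp_in_sum0 F2 faces_neq0; rewrite card_F2.
move=> sum0 im_le ker_le cardA; left; rewrite -(@leq_exp2l 2) // addn1 expnS expnD cardA mulnA.
by apply: leq_mul ker_le; rewrite -sum0 leq_mul2l im_le orbT.
Qed.

Lemma sum_face_walks g :
    (forall B : {set {set V}}, B \subset A -> B != set0 -> even_edge_set B -> (g <= #|B|)%N) ->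
  (g * #|faces| <= 2 * #|A|)%N.
Proof.
move=> girth; apply: (@leq_trans (\sum_(t in faces) #|face_walk t|)).
  rewrite mulnC -sum_nat_const; apply: leq_sum => t /setIdP[_ walk_neq0].
  by apply: girth walk_neq0 (@face_walk_even t); apply/subsetP => e /setIdP[].
have -> : (\sum_(t in faces) #|face_walk t| =
      \sum_(e in A) #|[set t in faces | e \in face_walk t]|)%N.
  rewrite -double_count; apply: eq_bigr => t _; apply: eq_card => e.
  by rewrite [RHS]inE andb_idl // => /setIdP[].
by rewrite mulnC -sum_nat_const; apply: leq_sum => e; exact: face_walks_at_edge.
Qed.

End MinorBound.
Section EvenEdgeSets.
Variables (V : finType) (B : {set {set V}}).
Hypothesis B_card : forall e, e \in B -> #|e| = 2%N.
Implicit Types (e : {set V}) (u v w : V) (X : {set V}).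

Definition neighbours u := [set w | [set u; w] \in B].

Lemma neighbours_neq u w : w \in neighbours u -> u != w.
Proof. by rewrite inE => /B_card; rewrite cards2; case: eqP. Qed.

Lemma card_neighbours u : #|neighbours u| = degree id B u.
Proof.
have pair_inj : {in neighbours u &, injective (fun w => [set u; w])}.
  move=> w w' /neighbours_neq uw _ /setP/(_ w).
  by rewrite !inE eqxx orbT eq_sym (negPf uw) => /esym/eqP.
rewrite -(card_in_imset pair_inj); apply: eq_card => e; rewrite inE; apply/imsetP/andP.
  by case=> w; rewrite inE => uwB ->; rewrite set21.
case=> eB ue; have /cards1P[w ew] : #|e :\ u| == 1%N.
  by have := cardsD1 u e; rewrite ue B_card //; lia.
by exists w; rewrite ?inE -ew setD1K.
Qed.

Lemma neighbours_cover u : neighbours u \subset cover B.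
Proof.
apply/subsetP => w; rewrite inE => uwB.
by apply/bigcupP; exists [set u; w]; rewrite ?set22.
Qed.

Definition bipartite_edges X := forall u v, [set u; v] \in B -> (u \in X) != (v \in X).

Hypothesis B_even : even_edge_set B.

Lemma even_card_neighbours_ge2 e u : e \in B -> u \in e -> (2 <= #|neighbours u|)%N.
Proof.
move=> eB ue; have := B_even u; rewrite card_neighbours.
have : (0 < degree id B u)%N by apply/card_gt0P; exists e; rewrite inE eB.
by case: (degree id B u) => [|[|]].
Qed.

Lemma even_card_cover_le : (#|cover B| <= #|B|)%N.
Proof.
rewrite -(@leq_pmul2r 2) // -[leqLHS]sum_nat_const -[leqRHS]sum_nat_const.
rewrite [leqRHS](_ : _ = \sum_(v in cover B) degree id B v)%N.
  apply: leq_sum => v /bigcupP[e eB ve].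
  by rewrite -card_neighbours; exact: even_card_neighbours_ge2 ve.
rewrite sum_degree; apply: eq_bigr => e eB.
by rewrite (setIidPl _) ?B_card //; exact: bigcup_sup.
Qed.

Lemma even_card_ge3 : B != set0 -> (3 <= #|B|)%N.
Proof.
case/set0Pn => e eB; have /eqP/cards2P[u [v [uv ee]]] := B_card eB.
have ue : u \in e by rewrite ee set21.
apply: leq_trans even_card_cover_le; apply: (@leq_trans #|u |: neighbours u|).
  have uN : u \notin neighbours u by apply/negP => /neighbours_neq; rewrite eqxx.
  by rewrite cardsU1 uN; exact: even_card_neighbours_ge2 ue.
apply: subset_leq_card; rewrite subUset sub1set neighbours_cover andbT.
by apply/bigcupP; exists e.
Qed.

Lemma even_bipartite_card_ge4 X : bipartite_edges X -> B != set0 -> (4 <= #|B|)%N.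
Proof.
move=> bip /set0Pn[e eB]; have /eqP/cards2P[u [v [uv ee]]] := B_card eB; subst e.
apply: leq_trans even_card_cover_le; apply: (@leq_trans #|neighbours u :|: neighbours v|).
  rewrite cardsU disjoint_setI0 ?cards0 ?subn0.
    exact: leq_add (even_card_neighbours_ge2 eB (set21 u v))
      (even_card_neighbours_ge2 eB (set22 u v)).
  apply/pred0P => w /=; apply/negbTE; rewrite !inE; apply/andP => -[/bip uw /bip vw].
  by move: (bip _ _ eB) uw vw; do 3!case: (_ \in X).
by apply: subset_leq_card; rewrite subUset !neighbours_cover.
Qed.

End EvenEdgeSets.

(* The bounds given by Euler's formula on the sphere and on the projective plane for
   girth 3 and, if the graph is bipartite, girth 4. *)
Definition sparse_edges (V : finType) (A : {set {set V}}) := A != set0 ->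
  (#|A| + 3 <= 3 * #|cover A|)%N /\
  (forall X, bipartite_edges A X -> (#|A| + 2 <= 2 * #|cover A|)%N).

Lemma minor_sparse (W V : finType) (E F : {set {set W}}) (A : {set {set V}})
    (beta : W -> option V) :
    two_sided E F -> H1_card_le2 E F -> (forall e, e \in A -> #|e| = 2%N) ->
  minor_model E A beta -> sparse_edges A.
Proof.
move=> EF H1_small A_card [branch_conn A_realized] /set0Pn[e eA].
have ex f : exists s, f \in A -> realizes E beta s f.
  by have [/A_realized[s sf]|_] := boolP (f \in A); [exists s|exists set0].
have [hat hatP] := fin_all_exists ex.
have A_sub f : f \in A -> f \subset cover A by exact: bigcup_sup.
have cover_ge2 : (2 <= #|cover A|)%N by rewrite -(A_card e) // subset_leq_card ?A_sub.
have cover_neq0 : cover A != set0 by rewrite -card_gt0 ltnW.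
have euler := minor_euler_bound EF H1_small A_card A_sub cover_neq0 branch_conn hatP.
have walks := sum_face_walks EF A_card hatP.
have sub_card (B : {set {set V}}) : B \subset A -> forall e, e \in B -> #|e| = 2%N.
  by move=> /subsetP BA f /BA/A_card.
split=> [|X bip].
  have := walks 3%N (fun B BA B0 B_even => even_card_ge3 (sub_card B BA) B_even B0).
  by move: euler cover_ge2; lia.
have sub_bip (B : {set {set V}}) : B \subset A -> bipartite_edges B X.
  by move=> /subsetP BA u v /BA/bip.
have := walks 4%N (fun B BA B0 B_even =>
  even_bipartite_card_ge4 (sub_card B BA) B_even (sub_bip B BA) B0).
by move: euler cover_ge2; lia.
Qed.

(** * Closed surfaces of positive Euler characteristic *)

Section EulerCohomology.
Variables (W : finType) (E F : {set {set W}}).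
Hypothesis EF : two_sided E F.

Lemma card_coboundaries : connected_in E [set: W] -> (2 ^ #|W| <= 2 * #|coboundaries E|)%N.
Proof.
move=> W_conn.
have zmodT : zmod_closed [in [set: {ffun W -> F2}]] by split=> [|f g _ _]; exact: in_setT.
have := card_image_ker zmodT (cob0B E); rewrite cardsT card_ffun card_F2 => ->.
rewrite mulnC leq_mul2r; apply/orP; right; rewrite -[leqRHS]card_F2.
pose const (x : F2) : {ffun W -> F2} := [ffun=> x].
apply: leq_trans (leq_imset_card const predT); apply: subset_leq_card.
apply/subsetP => f /setIdP[_ /eqP f0].
have f_const v w : f v = f w.
  apply: (connected_in_eq (f := f) W_conn); rewrite ?inE // => {}v {}w _ _ vwE.
  have /eqP := cob0_pair EF f vwE; rewrite f0 ffunE eq_sym addr_eq0 F2_opp => /eqP //.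
have [v _|noW] := pickP W.
  by apply/imsetP; exists (f v) => //; apply/ffunP => w; rewrite ffunE (f_const w v).
by apply/imsetP; exists 0 => //; apply/ffunP => v; have := noW v.
Qed.

Lemma card_cocycles : F != set0 ->
    (forall t t', t \in F -> t' \in F -> connect (dual_adj F E) t t') ->
  (#|cocycles E F| * 2 ^ #|F| <= 2 ^ #|E|.+1)%N.
Proof.
move=> F_neq0 dual_conn.
have := card_image_ker (supp_in_zmod_closed F2 E) (cob1B E F).
rewrite card_supp_in card_F2 -/(cocycles E F).
have im : [set k in supp_in F2 F | \sum_(t in F) k t == 0] \subset cob1 E F @: supp_in F2 E.
  apply/subsetP => k /setIdP[/supp_inP kF /eqP k0].
  have [t tF|x xE cob_x] := @cob1_solve _ _ _ EF E k (subxx _).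
    rewrite -[RHS]k0; apply: eq_bigl => s.
    by have [sF|] := boolP (s \in F); rewrite //= dual_conn.
  apply/imsetP; exists x => //; apply/ffunP => t.
  by have [tF|tF] := boolP (t \in F); [rewrite cob_x|rewrite kF // ffunE (negPf tF)].
have := subset_leq_card im; rewrite -card_gt0 in F_neq0; have := card_supp_in_sum0 F2 F_neq0.
by rewrite card_F2 expnS => <- im_le ->; rewrite mulnC -mulnA leq_mul2l leq_mul2r im_le orbT.
Qed.

Lemma euler_H1_card_le2 : connected_in E [set: W] -> F != set0 ->
    (forall t t', t \in F -> t' \in F -> connect (dual_adj F E) t t') ->
    (#|E| < #|W| + #|F|)%N ->
  H1_card_le2 E F.
Proof.
move=> W_conn F_neq0 dual_conn euler; apply: leq_trans (card_coboundaries W_conn).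
rewrite -(@leq_pmul2r (2 ^ #|F|)) ?expn_gt0 // -expnD.
by apply: leq_trans (card_cocycles F_neq0 dual_conn) _; rewrite leq_exp2l.
Qed.

End EulerCohomology.

Definition edges_of (W : finType) (K : {set {set W}}) := [set s in K | #|s| == 2].
Definition triangles_of (W : finType) (K : {set {set W}}) := [set s in K | #|s| == 3].

Section SurfaceComplex.
Variables (n : nat) (K : {set {set 'I_n}}).
Hypothesis K_surface : closed_surface_complex K.
Implicit Types (s t : {set 'I_n}) (u v w : 'I_n).

Lemma surface_face s t : s != set0 -> s \subset t -> t \in K -> s \in K.
Proof. by case: K_surface => -[_ _ K_face] _ _ _ _; exact: K_face. Qed.

Lemma surface_pure s : s \in K -> exists2 t, t \in triangles_of K & s \subset t.
Proof.
case: K_surface => _ pure _ _ _ /pure[t [tK t3 st]]; exists t => //.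
by rewrite inE tK t3.
Qed.

Lemma surface_two_sided : two_sided (edges_of K) (triangles_of K).
Proof.
split=> [e /setIdP[_ /eqP]|t /setIdP[_ /eqP]|t e /setIdP[tK _] et e2|e /setIdP[eK /eqP e2]] //.
  by rewrite inE e2 eqxx andbT; apply: surface_face et tK; rewrite -card_gt0 e2.
case: K_surface => _ _ /(_ _ eK e2) <- _ _.
by apply: eq_card => t; rewrite !inE andbA.
Qed.

Lemma surface_connected : connected_in (edges_of K) [set: 'I_n].
Proof.
case: K_surface => _ _ _ _ K_conn v w _ _; apply: connect_sub (K_conn v w) => {}v {}w /= vwK.
have [->|vw] := eqVneq v w; first exact: connect0.
by apply: connect1; rewrite /adj_in /= !inE vwK cards2 vw.
Qed.

Let dual := dual_adj (triangles_of K) (edges_of K).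

Lemma dual_adj_common_edge v w s t : v != w -> s \in triangles_of K -> t \in triangles_of K ->
  [set v; w] \subset s -> [set v; w] \subset t -> dual s t.
Proof.
move=> vw sT tT vws vwt; rewrite /dual /dual_adj /= sT tT; apply/existsP.
exists [set v; w]; rewrite vws vwt !andbT.
by apply: (triangle_edge surface_two_sided sT vws); rewrite cards2 vw.
Qed.

Lemma triangle_other_vertex v t : t \in triangles_of K -> v \in t ->
  exists2 w, w != v & [set v; w] \subset t.
Proof.
move=> /(triangle_card surface_two_sided) t3 vt.
have /card_gt0P[w] : (0 < #|t :\ v|)%N by rewrite -(ltn_add2l (v \in t)) -cardsD1 t3 vt.
by rewrite !inE => /andP[wv wt]; exists w => //; rewrite subUset !sub1set vt.
Qed.

Lemma surface_star_connected v s t : s \in triangles_of K -> t \in triangles_of K ->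
  v \in s -> v \in t -> connect dual s t.
Proof.
move=> sT tT vs vt.
have [w wv vws] := triangle_other_vertex sT vs; have [w' w'v vwt] := triangle_other_vertex tT vt.
have edgeK u r : r \in triangles_of K -> [set v; u] \subset r -> [set v; u] \in K.
  by move=> /setIdP[rK _] vur; apply: surface_face vur rK; apply/set0Pn; exists v; exact: set21.
have : connect (link_adj K v) w w'.
  case: K_surface => _ _ _ link_conn _.
  exact: link_conn wv w'v (edgeK _ _ sT vws) (edgeK _ _ tT vwt).
case/connectP => p; elim: p w s wv sT vws {vs} => [|x p IHp] w s wv sT vws /=.
  move=> _ w'w; subst w'; apply: connect1.
  by apply: (@dual_adj_common_edge v w); rewrite // eq_sym.
case/andP => /andP[vwx3 vwxK] pth lst.
have rT : [set v; w; x] \in triangles_of K by rewrite inE vwxK.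
have xv : x != v.
  by apply: contraTneq vwx3 => ->; rewrite setUAC setUid cards2; case: (v == w).
apply: (@connect_trans _ _ [set v; w; x]).
  by apply: connect1; apply: (@dual_adj_common_edge v w); rewrite ?subsetUl // eq_sym.
by apply: (IHp x) pth lst; rewrite // subUset !sub1set !inE !eqxx !orbT.
Qed.

Lemma surface_dual_connected s t :
  s \in triangles_of K -> t \in triangles_of K -> connect dual s t.
Proof.
move=> sT tT.
have nonempty r : r \in triangles_of K -> exists v, v \in r.
  by move=> /(triangle_card surface_two_sided) r3; apply/card_gt0P; rewrite r3.
have [v vs] := nonempty _ sT; have [w wt] := nonempty _ tT.
have : connect [rel a b | [set a; b] \in K] v w by case: K_surface.
case/connectP => p; elim: p v s sT vs => [|x p IHp] v s sT vs /=.
  by move=> _ wv; subst w; exact: surface_star_connected vs wt.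
case/andP => vxK pth lst; have [r rT] := surface_pure vxK.
rewrite subUset !sub1set => /andP[vr xr].
exact: connect_trans (surface_star_connected sT rT vs vr) (IHp x _ rT xr pth lst).
Qed.

Lemma surface_simplex_card s : s \in K -> [|| #|s| == 1, #|s| == 2 | #|s| == 3]%N.
Proof.
move=> sK; have [t /(triangle_card surface_two_sided) t3 /subset_leq_card] := surface_pure sK.
have : (0 < #|s|)%N by rewrite card_gt0; apply: contraTneq sK => ->; case: K_surface => -[].
by rewrite t3; case: #|s| => [|[|[|[|?]]]].
Qed.

Lemma complex_euler_charE :
  complex_euler_char K = n%:Z - #|edges_of K|%:Z + #|triangles_of K|%:Z.
Proof.
have card_sum k : #|[set s in K | #|s| == k]|%:Z = \sum_(s in K) (#|s| == k)%:R.
  rewrite -sum1dep_card (big_morph Posz PoszD (erefl _)) big_mkcondr.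
  by apply: eq_bigr => s _; case: eqP.
have -> : n%:Z = #|[set s in K | #|s| == 1%N]|%:Z.
  congr Posz; transitivity #|[set [set v] | v : 'I_n]|.
    by rewrite card_imset ?card_ord //; exact: set1_inj.
  apply: eq_card => s.
  rewrite inE; apply/imsetP/andP => [[v _ ->]|[sK /cards1P[v ->]]]; last by exists v.
  by rewrite cards1; case: K_surface => -[_ -> _].
rewrite /edges_of /triangles_of !card_sum -sumrB -big_split /=; apply: eq_bigr => s sK.
by have /or3P[] := surface_simplex_card sK => /eqP ->.
Qed.

Lemma surface_H1_card_le2 : 0 < complex_euler_char K ->
  H1_card_le2 (edges_of K) (triangles_of K).
Proof.
move=> chi; apply: euler_H1_card_le2.
- exact: surface_two_sided.
- exact: surface_connected.
- apply: contraTneq chi => T0; rewrite /complex_euler_char big1 // => s sK.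
  by have [t] := surface_pure sK; rewrite T0 inE.
- exact: surface_dual_connected.
- by move: chi; rewrite complex_euler_charE card_ord; lia.
Qed.

End SurfaceComplex.

(** * Subdivision of a closed surface *)

Definition apexes (T : finType) (F : {set {set T}}) (e : {set T}) :=
  [set v | (v \notin e) && (v |: e \in F)].

Lemma card_apexes (T : finType) (F : {set {set T}}) (e : {set T}) :
    (forall t, t \in F -> #|t| = #|e|.+1) ->
  #|apexes F e| = #|[set t in F | e \subset t]|.
Proof.
move=> F_card; have apex_inj : {in apexes F e &, injective (fun v => v |: e)}.
  move=> v w /setIdP[ve _] _ /setP/(_ v).
  by rewrite !inE eqxx (negPf ve) !orbF => /esym/eqP.
rewrite -(card_in_imset apex_inj); apply: eq_card => t; rewrite inE; apply/imsetP/andP.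
  by case=> v /setIdP[_ vF] ->; rewrite vF subsetUr.
case=> tF et; have /cards1P[v tv] : #|t :\: e| == 1%N by rewrite cardsDS // F_card // subSnn.
have tE : t = v |: e by rewrite -(setID t e) (setIidPr et) tv setUC.
have : v \in t :\: e by rewrite tv set11.
by rewrite inE => /andP[ve _]; exists v; rewrite // inE ve -tE.
Qed.

Section Grid.
Variables (n N : nat) (K : {set {set 'I_n}}).
Implicit Types (s t : {set 'I_n}) (i j k l : 'I_n).

Definition gpoint := {ffun 'I_n -> 'I_N.+1}.
Implicit Types (a b c : gpoint).

Definition coord a i : nat := a i.
Definition gsupp a := [set i | (0 < coord a i)%N].
Definition on_grid a := (\sum_i coord a i == N)%N.
Definition gclose a b :=
  [forall i, (coord a i <= coord b i + 1) && (coord b i <= coord a i + 1)]%N.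

(* The subdivision of every triangle of K into N^2 triangles; the point a has
   barycentric coordinates coord a i / N. *)
Definition grid_complex : {set {set gpoint}} :=
  [set s : {set gpoint} | [&& s != set0, [forall a in s, on_grid a],
     [forall a in s, [forall b in s, gclose a b]] & \bigcup_(a in s) gsupp a \in K]].

Lemma coord_inj a b : coord a =1 coord b -> a = b.
Proof. by move=> ab; apply/ffunP => i; apply: val_inj; exact: ab. Qed.

Lemma gcloseP a b : reflect
  (forall i, coord a i <= coord b i + 1 /\ coord b i <= coord a i + 1)%N (gclose a b).
Proof. by apply: (iffP forallP) => ab i; apply/andP. Qed.

Lemma gclose_refl a : gclose a a.
Proof. by apply/gcloseP => i; lia. Qed.

Lemma gclose_sym a b : gclose a b = gclose b a.
Proof. by apply: eq_forallb => i; rewrite andbC. Qed.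

Lemma coord_out a s i : gsupp a \subset s -> i \notin s -> coord a i = 0%N.
Proof. by move=> /subsetP a_sub; apply: contraNeq => ai; apply: a_sub; rewrite inE lt0n. Qed.

Lemma on_grid_sum a s : on_grid a -> gsupp a \subset s -> (\sum_(i in s) coord a i = N)%N.
Proof.
move=> /eqP aN a_sub; rewrite -[RHS]aN big_mkcond; apply: eq_bigr => i _.
by case: ifPn => // /(coord_out a_sub).
Qed.

Lemma on_grid_le2 a i j : on_grid a -> i != j -> (coord a i + coord a j <= N)%N.
Proof.
move=> /eqP aN ij; rewrite -[leqRHS]aN (bigD1 i) //= (bigD1 j) 1?eq_sym //=.
by rewrite addnA leq_addr.
Qed.

Lemma on_grid_sum3 a i j k : on_grid a -> gsupp a \subset [set i; j; k] ->
  i != j -> j != k -> i != k -> (coord a i + coord a j + coord a k = N)%N.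
Proof. by move=> aN a_sub ij jk ik; rewrite -(on_grid_sum aN a_sub) big_set3. Qed.

Lemma coord_eq_triangle a b i j k : gsupp a \subset [set i; j; k] ->
    gsupp b \subset [set i; j; k] ->
  coord a i = coord b i -> coord a j = coord b j -> coord a k = coord b k -> a = b.
Proof.
move=> a_sub b_sub abi abj abk; apply: coord_inj => l.
have [|lt] := boolP (l \in [set i; j; k]); last first.
  by rewrite (coord_out a_sub lt) (coord_out b_sub lt).
by rewrite !inE => /orP[/orP[]|] /eqP ->.
Qed.

Definition gpoint_of (h : 'I_n -> nat) : gpoint := [ffun l => inord (h l)].

Lemma coord_gpoint_of h i : (h i <= N)%N -> coord (gpoint_of h) i = h i.
Proof. by move=> hi; rewrite /coord ffunE inordK. Qed.

(* The grid point a + e_i - e_j. *)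
Definition shift i j a := gpoint_of (fun l => coord a l + (l == i) - (l == j))%N.

Section Shift.
Variables (i j : 'I_n) (a : gpoint).
Hypotheses (ij : i != j) (aN : on_grid a) (aj : (0 < coord a j)%N).

Lemma coord_shift l : (coord (shift i j a) l + (l == j) = coord a l + (l == i))%N.
Proof.
have ai_le := on_grid_le2 aN ij.
have al_le : (coord a l <= N)%N by exact: leq_ord.
rewrite /shift coord_gpoint_of; have [->|li] := eqVneq l i; rewrite ?(negPf ij).
- by lia.
- by have [->|] := eqVneq l j; lia.
- by lia.
- by have [->|] := eqVneq l j; lia.
Qed.

Lemma coord_shift_to : coord (shift i j a) i = (coord a i + 1)%N.
Proof. by have := coord_shift i; rewrite eqxx (negPf ij) addn0. Qed.

Lemma coord_shift_from : (coord (shift i j a) j + 1)%N = coord a j.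
Proof. by have := coord_shift j; rewrite eqxx eq_sym (negPf ij) addn0. Qed.

Lemma coord_shift_other l : l != i -> l != j -> coord (shift i j a) l = coord a l.
Proof. by move=> /negPf li /negPf lj; have := coord_shift l; rewrite li lj !addn0. Qed.

Lemma on_grid_shift : on_grid (shift i j a).
Proof.
have sum_pred1 k : (\sum_l (l == k :> 'I_n) = 1)%N.
  by rewrite (bigD1 k) //= eqxx big1 ?addn0 // => l /negPf ->.
rewrite /on_grid -(eqn_add2r 1) -[X in (_ + X)%N](sum_pred1 j) -big_split /=.
by rewrite (eq_bigr _ (fun l _ => coord_shift l)) big_split /= sum_pred1 (eqP aN).
Qed.

Lemma gsupp_shift : gsupp (shift i j a) \subset i |: gsupp a.
Proof.
apply/subsetP => l; rewrite !inE; have := coord_shift l.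
by have [//|_] := eqVneq l i; lia.
Qed.

Lemma gclose_shift : gclose a (shift i j a).
Proof. by apply/gcloseP => l; have := coord_shift l; do 2!case: eqP => _ /=; lia. Qed.

Lemma shift_neq : shift i j a != a.
Proof.
by apply/eqP => /(congr1 (coord^~ i)); rewrite coord_shift_to; lia.
Qed.

End Shift.

Lemma shiftK i j a : i != j -> on_grid a -> (0 < coord a j)%N -> shift j i (shift i j a) = a.
Proof.
move=> ij aN aj; have ji : j != i by rewrite eq_sym.
have si : (0 < coord (shift i j a) i)%N.
  by rewrite coord_shift_to // addn1.
apply: coord_inj => l; have := coord_shift ji (on_grid_shift ij aN aj) si l.
by have := coord_shift ij aN aj l; lia.
Qed.

Hypothesis N_gt0 : (0 < N)%N.
Hypothesis K_surface : closed_surface_complex K.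

Lemma on_grid_supp a : on_grid a -> gsupp a != set0.
Proof.
move=> /eqP aN; apply: contraTneq N_gt0 => a0; rewrite -aN big1 // => i _.
by apply: (@coord_out _ set0); rewrite ?a0 ?inE.
Qed.

Lemma mem_grid_complex (s : {set gpoint}) t : s != set0 -> t \in K ->
    (forall a, a \in s -> on_grid a /\ gsupp a \subset t) -> {in s &, forall a b, gclose a b} ->
  s \in grid_complex.
Proof.
move=> s_neq0 tK s_grid s_close; rewrite inE s_neq0 /=; apply/and3P; split.
- by apply/forall_inP => a /s_grid[].
- by apply/forall_inP => a sa; apply/forall_inP => b; exact: s_close.
- apply: (surface_face K_surface _ _ tK); last by apply/bigcupsP => a /s_grid[].
  have /set0Pn[a sa] := s_neq0; have [/on_grid_supp/set0Pn[i ai] _] := s_grid a sa.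
  by apply/set0Pn; exists i; apply/bigcupP; exists a.
Qed.

Lemma grid_complexP (s : {set gpoint}) : s \in grid_complex ->
  [/\ forall a, a \in s -> on_grid a, {in s &, forall a b, gclose a b}
   & exists2 t, t \in triangles_of K & forall a, a \in s -> gsupp a \subset t].
Proof.
rewrite inE => /and4P[_ /forall_inP s_grid /forall_inP s_close sK]; split=> //.
  by move=> a b sa sb; apply: (forall_inP (s_close a sa)).
have [t tT /subsetP st] := surface_pure K_surface sK; exists t => // a sa.
by apply/subsetP => i ia; apply: st; apply/bigcupP; exists a.
Qed.

Lemma grid_edge a b t : t \in K -> on_grid a -> on_grid b -> gsupp a \subset t ->
  gsupp b \subset t -> gclose a b -> a != b -> [set a; b] \in edges_of grid_complex.
Proof.
move=> tK aN bN a_sub b_sub ab neq; rewrite inE cards2 neq eqxx andbT.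
apply: mem_grid_complex tK _ _ => [|c|c c'].
- by apply/set0Pn; exists a; exact: set21.
- by rewrite !inE => /orP[] /eqP ->.
- by rewrite !inE => /orP[] /eqP -> /orP[] /eqP ->; rewrite ?gclose_refl // gclose_sym.
Qed.

Lemma grid_triangle a b c t : t \in K -> on_grid a -> on_grid b -> on_grid c ->
    gsupp a \subset t -> gsupp b \subset t -> gsupp c \subset t ->
    gclose a b -> gclose b c -> gclose a c -> a != b -> b != c -> a != c ->
  [set a; b; c] \in triangles_of grid_complex.
Proof.
move=> tK aN bN cN a_sub b_sub c_sub ab bc ac nab nbc nac.
have abc3 : #|[set a; b; c]| == 3%N.
  by rewrite -setUA cardsU1 cards2 !inE negb_or nab nac nbc.
rewrite inE abc3 andbT; apply: mem_grid_complex tK _ _ => [|x|x y].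
- by apply/set0Pn; exists a; rewrite !inE eqxx.
- by rewrite !inE => /orP[/orP[]|] /eqP ->.
- by rewrite !inE => /orP[/orP[]|] /eqP -> /orP[/orP[]|] /eqP ->;
    rewrite ?gclose_refl // gclose_sym.
Qed.

Lemma grid_edgeP a b : [set a; b] \in edges_of grid_complex ->
  [/\ a != b, on_grid a, on_grid b, gclose a b &
    exists2 t, t \in triangles_of K & gsupp a \subset t /\ gsupp b \subset t].
Proof.
move=> /setIdP[/grid_complexP[s_grid s_close [t tT st]]]; rewrite cards2.
case: (eqVneq a b) => //= ab _; split=> //.
- by apply: s_grid; exact: set21.
- by apply: s_grid; exact: set22.
- exact: s_close (set21 a b) (set22 a b).
- by exists t => //; split; apply: st; rewrite ?set21 ?set22.
Qed.

Lemma on_grid_lt a b : on_grid a -> on_grid b -> a != b -> exists i, (coord a i < coord b i)%N.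
Proof.
move=> /eqP aN /eqP bN ab; apply/existsP; apply: contraNT ab => /existsPn b_le.
apply/eqP/coord_inj => i.
have le l : (coord b l <= coord a l)%N by rewrite leqNgt.
have := @leqif_sum _ predT _ _ _ (fun l _ => leqif_eq (le l)).
by rewrite aN bN => -[_]; rewrite eqxx => /esym/forallP/(_ i)/eqP.
Qed.

Lemma grid_edge_shift a b : [set a; b] \in edges_of grid_complex ->
  exists i j, [/\ i != j, (0 < coord a j)%N & b = shift i j a].
Proof.
case/grid_edgeP => ab aN bN /gcloseP close_ab [t tT [a_sub b_sub]].
have ba : b != a by rewrite eq_sym.
have [i abi] := on_grid_lt aN bN ab; have [j baj] := on_grid_lt bN aN ba.
have bi : coord b i = (coord a i + 1)%N by have [_] := close_ab i; clear -abi; lia.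
have bj : (coord b j + 1 = coord a j)%N by have [+ _] := close_ab j; clear -baj; lia.
have ij : i != j by apply: contraTneq abi => ->; rewrite -leqNgt ltnW.
have aj : (0 < coord a j)%N by rewrite -bj addn1.
exists i, j; split=> //; apply: coord_inj => l; apply: (@addIn (l == j)).
rewrite coord_shift //; have [->|li] := eqVneq l i; first by rewrite (negPf ij) addn0.
have [->|lj] := eqVneq l j; first by rewrite addn0.
rewrite !addn0; have [lt|lt] := boolP (l \in t); last first.
  by rewrite (coord_out a_sub lt) (coord_out b_sub lt).
have [it jt] : i \in t /\ j \in t.
  by split; [apply: (subsetP b_sub); rewrite inE bi addn1|apply: (subsetP a_sub); rewrite inE].
have t3 := triangle_card (surface_two_sided K_surface) tT.
have [k [tE ik jk]] := cards3_third t3 it jt ij; subst t.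
have lk : l = k by move: lt; rewrite !inE (negPf li) (negPf lj) => /eqP.
subst l; have := on_grid_sum3 aN a_sub ij jk ik; have := on_grid_sum3 bN b_sub ij jk ik.
by clear -bi bj; lia.
Qed.

Section EdgeApexes.
Variables (i j : 'I_n) (a : gpoint).
Hypotheses (ij : i != j) (aN : on_grid a) (aj : (0 < coord a j)%N).
Hypothesis aK : i |: gsupp a \in K.
Let b := shift i j a.
Let bN : on_grid b := on_grid_shift ij aN aj.

Lemma grid_apexI c t : t \in K -> gsupp a \subset t -> gsupp b \subset t -> gsupp c \subset t ->
  on_grid c -> gclose a c -> gclose b c -> c != a -> c != b ->
  c \in apexes (triangles_of grid_complex) [set a; b].
Proof.
move=> tK a_sub b_sub c_sub cN ac bc ca cb; apply/setIdP; split.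
  by rewrite !inE negb_or ca cb.
rewrite setUC; apply: (grid_triangle tK) => //; rewrite 1?eq_sym ?shift_neq //.
exact: gclose_shift.
Qed.

Lemma grid_apex_up k : k \notin [set i; j] -> k |: (i |: gsupp a) \in K ->
  shift k j a \in apexes (triangles_of grid_complex) [set a; b].
Proof.
rewrite in_set2 negb_or => /andP[ki kj] kK.
have [bE cE] := (coord_shift ij aN aj, coord_shift kj aN aj).
apply: (grid_apexI kK).
- by rewrite setUA subsetUr.
- by apply: subset_trans (gsupp_shift ij aN aj) _; rewrite subsetUr.
- by apply: subset_trans (gsupp_shift kj aN aj) _; rewrite setUCA subsetUr.
- exact: on_grid_shift.
- exact: gclose_shift.
- by apply/gcloseP => l; move: (bE l) (cE l); rewrite -/b; clear; lia.
- exact: shift_neq.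
- apply/eqP => /(congr1 (coord^~ k)); rewrite coord_shift_to // coord_shift_other //; lia.
Qed.

Lemma grid_apex_down k : k \notin [set i; j] -> (0 < coord a k)%N ->
  shift i k a \in apexes (triangles_of grid_complex) [set a; b].
Proof.
rewrite in_set2 negb_or => /andP[ki kj] ak; have ik : i != k by rewrite eq_sym.
have [bE cE] := (coord_shift ij aN aj, coord_shift ik aN ak).
apply: (grid_apexI aK).
- exact: subsetUr.
- exact: gsupp_shift.
- exact: gsupp_shift.
- exact: on_grid_shift.
- exact: gclose_shift.
- by apply/gcloseP => l; move: (bE l) (cE l); rewrite -/b; clear; lia.
- exact: shift_neq.
- apply/eqP => /(congr1 (coord^~ k)); rewrite [RHS]coord_shift_other //.
  by have := coord_shift_from ik aN ak; lia.
Qed.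

Lemma grid_apexP c : c \in apexes (triangles_of grid_complex) [set a; b] ->
  exists2 k, k \notin [set i; j] &
    (c = shift k j a /\ k |: (i |: gsupp a) \in K) \/ (c = shift i k a /\ (0 < coord a k)%N).
Proof.
case/setIdP => + /setIdP[/grid_complexP[s_grid s_close [t tT st]] _].
rewrite !inE negb_or => /andP[ca cb].
have [as_ bs cs] : [/\ a \in c |: [set a; b], b \in c |: [set a; b] & c \in c |: [set a; b]].
  by rewrite !inE !eqxx !orbT.
have /setIdP[tK /eqP t3] := tT.
have acE : [set a; c] \in edges_of grid_complex.
  apply: (grid_edge tK); rewrite 1?eq_sym //; [exact: s_grid|exact: st|exact: st|exact: s_close].
have [k [m [km am cE]]] := grid_edge_shift acE.
have in_t l x : x \in c |: [set a; b] -> (0 < coord x l)%N -> l \in t.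
  by move=> /st/subsetP xt xl; apply: xt; rewrite inE.
have it : i \in t by apply: (in_t i b) => //; rewrite coord_shift_to // addn1.
have jt : j \in t by exact: (in_t j a).
have kt : k \in t by apply: (in_t k c) => //; rewrite cE coord_shift_to // addn1.
have mt : m \in t by exact: (in_t m a).
have /gcloseP bc := s_close _ _ bs cs.
have [mj|mj] := eqVneq m j.
  subst m; have ki : k != i by apply: contraNneq cb => ki; rewrite cE ki.
  exists k; [by rewrite !inE negb_or ki|left; split=> //].
  apply: (surface_face K_surface _ _ tK); first by apply/set0Pn; exists k; rewrite setU11.
  by rewrite !subUset !sub1set kt it (st a).
have [ki|ki] := eqVneq k i.
  subst k; exists m; [by rewrite !inE negb_or mj eq_sym km|by right].
exfalso; have [kj|kj] := eqVneq k j.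
  subst k; have [_] := bc j; rewrite cE coord_shift_to // -(coord_shift_from ij aN aj) -/b.
  by clear; lia.
have [mi|mi] := eqVneq m i.
  subst m; have [+ _] := bc i; rewrite coord_shift_to // cE -(coord_shift_from km aN am).
  by clear; lia.
have : (#|[set i; j; k; m]| <= #|t|)%N.
  by apply: subset_leq_card; rewrite !subUset !sub1set it jt kt mt.
rewrite t3 -!setUA !cardsU1 cards1 !inE !negb_or ij km.
by rewrite ![i == _]eq_sym ![j == _]eq_sym ki mi kj mj.
Qed.

Lemma card_grid_apexes_interior k : k \notin [set i; j] -> (0 < coord a k)%N ->
  #|apexes (triangles_of grid_complex) [set a; b]| = 2%N.
Proof.
move=> kij ak; have akK : k |: (i |: gsupp a) \in K.
  by rewrite (setUidPr _) // sub1set !inE ak orbT.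
have only l : l \notin [set i; j] -> l |: (i |: gsupp a) \in K -> l = k.
  move=> lij lK; apply/eqP; apply: contraLR isT => lk.
  have : (#|[set l; k; i; j]| <= 3)%N.
    have /or3P cards := surface_simplex_card K_surface lK.
    apply: leq_trans (subset_leq_card _) (_ : #|l |: (i |: gsupp a)| <= 3)%N; last first.
      by case: cards => /eqP ->.
    by rewrite !subUset !sub1set !inE !eqxx ak aj !orbT.
  move: lij kij; rewrite !inE !negb_or => /andP[li lj] /andP[ki kj].
  by rewrite -!setUA !cardsU1 cards1 !inE !negb_or lk li lj ki kj ij.
have -> : apexes (triangles_of grid_complex) [set a; b] = [set shift k j a; shift i k a].
  apply/eqP; rewrite eqEsubset subUset !sub1set grid_apex_up // grid_apex_down // !andbT.
  apply/subsetP => c /grid_apexP[l lij c_shift]; have lk : l = k.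
    case: c_shift => [[_ lK]|[_ al]]; apply: only => //.
    by rewrite (setUidPr _) // sub1set !inE al orbT.
  by subst l; case: c_shift => -[-> _]; rewrite in_set2 eqxx ?orbT.
have [ik kj] : i != k /\ k != j by move: kij; rewrite !inE negb_or eq_sym => /andP.
rewrite cards2; case: eqVneq => // /(congr1 (coord^~ k)).
by rewrite coord_shift_to //; have := coord_shift_from ik aN ak; lia.
Qed.

Lemma card_grid_apexes_boundary : gsupp a \subset [set i; j] ->
  #|apexes (triangles_of grid_complex) [set a; b]| = 2%N.
Proof.
move=> a_sub; have K_two_sided := surface_two_sided K_surface.
have aE : i |: gsupp a = [set i; j].
  apply/eqP; rewrite eqEsubset subUset sub1set set21 a_sub /= subUset !sub1set setU11.
  by rewrite !inE aj orbT.
have ijE : [set i; j] \in edges_of K by rewrite inE -aE aK aE cards2 ij.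
have K_card t : t \in triangles_of K -> #|t| = #|[set i; j]|.+1.
  by move=> /(triangle_card K_two_sided); rewrite cards2 ij.
rewrite -(edge_triangles K_two_sided ijE) -(card_apexes K_card).
have shift_inj : {in apexes (triangles_of K) [set i; j] &, injective (fun k => shift k j a)}.
  move=> k l /setIdP[+ _] /setIdP[+ _]; rewrite !inE !negb_or => /andP[_ kj] /andP[_ lj].
  move=> /(congr1 (coord^~ k)); rewrite coord_shift_to //; have [//|kl] := eqVneq k l.
  by rewrite coord_shift_other //; clear; lia.
rewrite -(card_in_imset shift_inj); apply: eq_card => c.
apply/idP/imsetP => [/grid_apexP[k kij]|].
  case=> [[-> kK]|[_ ak]].
    exists k => //; rewrite inE kij inE -aE kK /= aE cardsU1 kij cards2 ij //.
  by move/subsetP: a_sub => /(_ k); rewrite inE ak (negPf kij) => /(_ isT).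
case=> k /setIdP[kij /setIdP[kK _]] ->.
by apply: grid_apex_up; rewrite // aE.
Qed.

End EdgeApexes.

Lemma grid_two_sided : two_sided (edges_of grid_complex) (triangles_of grid_complex).
Proof.
split=> [e /setIdP[_ /eqP]|t /setIdP[_ /eqP]|t e /setIdP[tT _] /subsetP et e2|e eE] //.
  have [s_grid s_close [t' /setIdP[t'K _] st]] := grid_complexP tT.
  rewrite inE e2 eqxx andbT; apply: (mem_grid_complex _ t'K) => [|x /et xt|x y /et xt /et yt].
  - by rewrite -card_gt0 e2.
  - by split; [exact: s_grid|exact: st].
  - exact: s_close.
have T_card (r : {set gpoint}) : r \in triangles_of grid_complex -> #|r| = #|e|.+1.
  by case/setIdP => _ /eqP ->; case/setIdP: eE => _ /eqP ->.
rewrite -(card_apexes T_card); have /cards2P[a [b [ab ee]]] : #|e| == 2%N.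
  by case/setIdP: eE.
subst e; have [_ aN _ _ [t tT [a_sub b_sub]]] := grid_edgeP eE.
have [i [j [ij aj bE]]] := grid_edge_shift eE; subst b.
have aK : i |: gsupp a \in K.
  case/setIdP: tT => tK _; apply: (surface_face K_surface _ _ tK).
    by apply/set0Pn; exists i; exact: setU11.
  rewrite subUset a_sub sub1set andbT; apply: (subsetP b_sub).
  by rewrite inE coord_shift_to // addn1.
have [a_bd|/subsetPn[k]] := boolP (gsupp a \subset [set i; j]).
  exact: card_grid_apexes_boundary.
by rewrite inE => ak kij; exact: card_grid_apexes_interior ak.
Qed.

End Grid.

(** * Cohomology of the subdivision *)

(* h, v and d are differences along the edges of a triangular lattice: h q r from (q, r)
   to (q+1, r), v q r from (q, r) to (q, r+1), and d q r from (q+1, r) to (q, r+1). *)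
Lemma ladder_primitive (A : zmodType) (N : nat) (h v d : nat -> nat -> A) :
    (forall q r, (q + r < N)%N -> h q r + d q r = v q r) ->
    (forall q r, (q + r + 1 < N)%N -> d q r + h q r.+1 = v q.+1 r) ->
  exists G : nat -> nat -> A, forall q r, (q + r < N)%N ->
    [/\ h q r = G q.+1 r - G q r, v q r = G q r.+1 - G q r & d q r = G q r.+1 - G q.+1 r].
Proof.
move=> up down; pose G q r := \sum_(x < q) h x 0%N + \sum_(y < r) v q y.
have G_v q r : v q r = G q r.+1 - G q r.
  by rewrite /G big_ord_recr /= addrA addrC addrK.
have G_h q r : (q + r < N)%N -> h q r = G q.+1 r - G q r.
  elim: r => [|r IHr] qr; first by rewrite /G !big_ord0 !addr0 big_ord_recr /= addrC addrK.
  have qr' : (q + r < N)%N by lia.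
  have -> : h q r.+1 = v q.+1 r - v q r + h q r.
    have qr1 : (q + r + 1 < N)%N by lia.
    by rewrite -(down _ _ qr1) -(up _ _ qr') [d q r + _]addrC [h q r + _]addrC addrKA subrK.
  by rewrite !G_v IHr // addrAC subrKA opprB subrKA.
exists G => q r qr; split; [exact: G_h|exact: G_v|].
have -> : d q r = v q r - h q r by rewrite -up // addrAC subrr add0r.
by rewrite G_v G_h // opprB subrKA.
Qed.

Section GridCohomology.
Variables (n N : nat) (K : {set {set 'I_n}}).
Hypothesis N_gt0 : (0 < N)%N.
Hypothesis K_surface : closed_surface_complex K.
Implicit Types (a b c : gpoint n N) (s t : {set 'I_n}) (i j k l : 'I_n).
Local Notation T := (grid_complex N K).
Let K_two_sided := surface_two_sided K_surface.
Let T_two_sided := grid_two_sided N_gt0 K_surface.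

Definition primitive_on (phi : {ffun {set gpoint n N} -> F2}) t (f : gpoint n N -> F2) :=
  forall a b, [set a; b] \in edges_of T -> gsupp a \subset t -> gsupp b \subset t ->
  phi [set a; b] = f a + f b.

Section TrianglePrimitive.
Variables (phi : {ffun {set gpoint n N} -> F2}) (i j k : 'I_n).
Hypothesis phi_cocycle : phi \in cocycles (edges_of T) (triangles_of T).
Hypotheses (ij : i != j) (jk : j != k) (ik : i != k).
Hypothesis tT : [set i; j; k] \in triangles_of K.

Definition triangle_point q r : gpoint n N := gpoint_of N (fun l =>
  if l == i then N - q - r else if l == j then q else if l == k then r else 0)%N.

Lemma coord_triangle_point q r : (q + r <= N)%N ->
  [/\ coord (triangle_point q r) i = (N - q - r)%N, coord (triangle_point q r) j = q,
   coord (triangle_point q r) k = r & gsupp (triangle_point q r) \subset [set i; j; k]].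
Proof.
move=> qr; have coordE l : coord (triangle_point q r) l =
    (if l == i then N - q - r else if l == j then q else if l == k then r else 0)%N.
  by rewrite coord_gpoint_of //; do 3?case: ifP => _; lia.
rewrite !coordE !eqxx ![_ == i]eq_sym [k == j]eq_sym (negPf ij) (negPf jk) (negPf ik).
split=> //; apply/subsetP => l; rewrite !inE coordE; do 3?case: ifP => //.
Qed.

Lemma triangle_pointE a : on_grid a -> gsupp a \subset [set i; j; k] ->
  (coord a j + coord a k <= N)%N /\ a = triangle_point (coord a j) (coord a k).
Proof.
move=> aN a_sub; have sum_a := on_grid_sum3 aN a_sub ij jk ik.
have le : (coord a j + coord a k <= N)%N by clear -sum_a; lia.
have [gi gj gk g_sub] := coord_triangle_point le.
split=> //; apply: (coord_eq_triangle a_sub g_sub); rewrite ?gi ?gj ?gk //.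
by clear -sum_a; lia.
Qed.

Lemma on_grid_triangle_point q r : (q + r <= N)%N -> on_grid (triangle_point q r).
Proof.
move=> qr; have [gi gj gk g_sub] := coord_triangle_point qr.
rewrite /on_grid (bigID (mem [set i; j; k])) /= big_set3 // gi gj gk.
rewrite big1 ?addn0 => [|l]; last first.
  exact: coord_out.
by apply/eqP => /=; clear -qr; lia.
Qed.

Lemma shift_triangle_point x y a : x \in [set i; j; k] -> x != y -> on_grid a ->
    gsupp a \subset [set i; j; k] -> (0 < coord a y)%N ->
  shift x y a = triangle_point (coord (shift x y a) j) (coord (shift x y a) k).
Proof.
move=> xt xy aN a_sub ay; apply: (triangle_pointE (on_grid_shift xy aN ay) _).2.
by apply: subset_trans (gsupp_shift xy aN ay) _; rewrite subUset sub1set xt.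
Qed.

Let ji : j != i. Proof. by rewrite eq_sym. Qed.
Let ki : k != i. Proof. by rewrite eq_sym. Qed.
Let kj : k != j. Proof. by rewrite eq_sym. Qed.

Let in_t : [/\ i \in [set i; j; k], j \in [set i; j; k] & k \in [set i; j; k]].
Proof. by rewrite !inE !eqxx !orbT. Qed.

Lemma shift_ji q r : (q + r < N)%N -> shift j i (triangle_point q r) = triangle_point q.+1 r.
Proof.
move=> qr; have [gi gj gk g_sub] := coord_triangle_point (ltnW qr); have [_ jt _] := in_t.
have gN := on_grid_triangle_point (ltnW qr).
have g0 : (0 < coord (triangle_point q r) i)%N by rewrite gi; clear -qr; lia.
by rewrite shift_triangle_point // coord_shift_to // coord_shift_other // gj gk addn1.
Qed.

Lemma shift_ki q r : (q + r < N)%N -> shift k i (triangle_point q r) = triangle_point q r.+1.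
Proof.
move=> qr; have [gi gj gk g_sub] := coord_triangle_point (ltnW qr); have [_ _ kt] := in_t.
have gN := on_grid_triangle_point (ltnW qr).
have g0 : (0 < coord (triangle_point q r) i)%N by rewrite gi; clear -qr; lia.
by rewrite shift_triangle_point // coord_shift_to // coord_shift_other // gj gk addn1.
Qed.

Lemma shift_kj q r : (q + r < N)%N -> shift k j (triangle_point q.+1 r) = triangle_point q r.+1.
Proof.
move=> qr; have qr' : (q.+1 + r <= N)%N by [].
have [gi gj gk g_sub] := coord_triangle_point qr'; have [_ _ kt] := in_t.
have gN := on_grid_triangle_point qr'.
have g0 : (0 < coord (triangle_point q.+1 r) j)%N by rewrite gj.
have := coord_shift_from kj gN g0; rewrite gj addn1 => -[from].
by rewrite shift_triangle_point // from coord_shift_to // gk addn1.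
Qed.

Lemma cocycle_apex a b c : [set a; b] \in edges_of T ->
    c \in apexes (triangles_of T) [set a; b] ->
  phi [set a; b] + phi [set b; c] = phi [set a; c].
Proof.
move=> /(edge_neq T_two_sided) ab /setIdP[+ abcT].
rewrite in_set2 negb_or !(eq_sym c) => /andP[ac bc].
have /setIdP[_ /eqP/ffunP/(_ (c |: [set a; b]))] := phi_cocycle.
rewrite setUC in abcT *; rewrite (cob1_triangle T_two_sided) // ffunE.
by move/eqP; rewrite addr_eq0 F2_opp => /eqP.
Qed.

Lemma triangle_face_mem x s : x |: s \subset [set i; j; k] -> x |: s \in K.
Proof.
move=> xs; have /setIdP[tK _] := tT; apply: surface_face xs tK => //.
by apply/set0Pn; exists x; exact: setU11.
Qed.

Lemma shift_edge x y a : x != y -> x \in [set i; j; k] -> on_grid a ->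
  gsupp a \subset [set i; j; k] -> (0 < coord a y)%N -> [set a; shift x y a] \in edges_of T.
Proof.
move=> xy xt aN a_sub ay; have /setIdP[tK _] := tT.
apply: (grid_edge N_gt0 K_surface tK) => //; first exact: on_grid_shift.
- by apply: subset_trans (gsupp_shift xy aN ay) _; rewrite subUset sub1set xt.
- exact: gclose_shift.
- by rewrite eq_sym shift_neq.
Qed.

Local Notation g := triangle_point.

Lemma cocycle_up q r : (q + r < N)%N ->
  phi [set g q r; g q.+1 r] + phi [set g q.+1 r; g q r.+1] = phi [set g q r; g q r.+1].
Proof.
move=> qr; have [gi _ _ g_sub] := coord_triangle_point (ltnW qr).
have gN := on_grid_triangle_point (ltnW qr); have [_ jt kt] := in_t.
have g0 : (0 < coord (g q r) i)%N by rewrite gi; clear -qr; lia.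
rewrite -shift_ji // -shift_ki //; apply: cocycle_apex; first exact: shift_edge.
apply: grid_apex_up; rewrite ?triangle_face_mem ?in_set2 ?negb_or ?kj //.
  by rewrite subUset sub1set jt.
by rewrite !subUset !sub1set kt jt.
Qed.

Lemma cocycle_down q r : (q + r + 1 < N)%N ->
  phi [set g q.+1 r; g q r.+1] + phi [set g q r.+1; g q.+1 r.+1] =
  phi [set g q.+1 r; g q.+1 r.+1].
Proof.
move=> qr; have qr' : (q.+1 + r.+1 <= N)%N by clear -qr; lia.
have [qr1 qr2] : (q + r.+1 < N /\ q.+1 + r < N)%N by clear -qr; lia.
have [gi gj gk g_sub] := coord_triangle_point qr'; have gN := on_grid_triangle_point qr'.
have [it jt kt] := in_t.
have bE : shift i j (g q.+1 r.+1) = g q r.+1.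
  rewrite -shift_ji // shiftK //; first exact/on_grid_triangle_point/ltnW.
  by have [-> _ _ _] := coord_triangle_point (ltnW qr1); clear -qr; lia.
have cE : shift i k (g q.+1 r.+1) = g q.+1 r.
  rewrite -shift_ki // shiftK //; first exact/on_grid_triangle_point/ltnW.
  by have [-> _ _ _] := coord_triangle_point (ltnW qr2); clear -qr; lia.
rewrite addrC ![[set _; g q.+1 r.+1]]setUC [[set g q.+1 r; g q r.+1]]setUC -bE -cE.
apply: cocycle_apex; first by apply: shift_edge; rewrite ?gj.
apply: grid_apex_down; rewrite ?gj ?gk ?triangle_face_mem ?in_set2 ?negb_or ?ki ?kj //.
by rewrite subUset sub1set it.
Qed.

Lemma triangle_primitive : exists f, primitive_on phi [set i; j; k] f.
Proof.
have [q r qr|G GP] := ladder_primitive (h := fun q r => phi [set g q r; g q.+1 r])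
  (v := fun q r => phi [set g q r; g q r.+1]) (d := fun q r => phi [set g q.+1 r; g q r.+1])
  cocycle_up; first exact: cocycle_down.
pose f a := G (coord a j) (coord a k); exists f.
have f_g q r : (q + r <= N)%N -> f (g q r) = G q r.
  by move=> qr; rewrite /f; have [_ -> -> _] := coord_triangle_point qr.
have oriented x y a : (x, y) \in [:: (j, i); (k, i); (k, j)] -> on_grid a ->
    gsupp a \subset [set i; j; k] -> (0 < coord a y)%N ->
      phi [set a; shift x y a] = f a + f (shift x y a).
  move=> xy aN a_sub ay; have [qr aE] := triangle_pointE aN a_sub.
  move: (coord a j) (coord a k) qr aE => q r qr aE; subst a.
  have [gi gj _ _] := coord_triangle_point qr; rewrite f_g //.
  move: xy; rewrite !inE => /or3P[] /eqP[? ?]; subst x y.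
  - have qr1 : (q + r < N)%N by move: ay; rewrite gi; clear; lia.
    by have [hE _ _] := GP _ _ qr1; rewrite shift_ji // f_g // hE F2_opp addrC.
  - have qr1 : (q + r < N)%N by move: ay; rewrite gi; clear; lia.
    by have [_ vE _] := GP _ _ qr1; rewrite shift_ki // f_g ?addnS // vE F2_opp addrC.
  - move: ay qr {aN a_sub gi}; rewrite gj; case: q {gj} => // q _ qr.
    by have [_ _ dE] := GP _ _ qr; rewrite shift_kj // f_g ?addnS // dE F2_opp addrC.
move=> a b abE a_sub b_sub; have [_ aN bN _ _] := grid_edgeP K_surface abE.
have [x [y [xy ay bE]]] := grid_edge_shift K_surface abE.
have bx : (0 < coord b x)%N by rewrite bE coord_shift_to // addn1.
have shift_ba : shift y x b = a by rewrite bE shiftK.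
have xt : x \in [set i; j; k] by apply: (subsetP b_sub); rewrite inE.
have yt : y \in [set i; j; k] by apply: (subsetP a_sub); rewrite inE.
pose pairs := [:: (j, i); (k, i); (k, j)].
have /orP[xy_pair|yx_pair] : ((x, y) \in pairs) || ((y, x) \in pairs).
- move: xy xt yt; rewrite !inE => xy /orP[/orP[]|] /eqP ? /orP[/orP[]|] /eqP ?; subst x y;
    by rewrite ?eqxx ?orbT // in xy *.
- by rewrite bE; exact: oriented.
- by rewrite setUC addrC -[in LHS]shift_ba oriented // shift_ba.
Qed.

End TrianglePrimitive.

Lemma local_primitives phi : phi \in cocycles (edges_of T) (triangles_of T) ->
  exists f : {set 'I_n} -> gpoint n N -> F2,
    forall t, t \in triangles_of K -> primitive_on phi t (f t).
Proof.
move=> phi_cocycle; have ex t : exists f, t \in triangles_of K -> primitive_on phi t f.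
  have [tT|_] := boolP (t \in triangles_of K); last by exists (fun=> 0).
  have [i [j [k [tE ij jk ik]]]] := cards3P (triangle_card K_two_sided tT); subst t.
  by have [f f_prim] := triangle_primitive phi_cocycle ij jk ik tT; exists f.
by have [f f_prim] := fin_all_exists ex; exists f.
Qed.

Definition corner i : gpoint n N := gpoint_of N (fun l => if l == i then N else 0%N).

Lemma coord_corner i l : coord (corner i) l = if l == i then N else 0%N.
Proof. by rewrite coord_gpoint_of; case: ifP. Qed.

Lemma gsupp_corner i : gsupp (corner i) = [set i].
Proof. by apply/setP => l; rewrite !inE coord_corner; case: eqP. Qed.

Lemma on_grid_corner i : on_grid (corner i).
Proof.
rewrite /on_grid (bigD1 i) //= coord_corner eqxx big1 ?addn0 // => l /negPf li.
by rewrite coord_corner li.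
Qed.

Lemma corner_eq a i : on_grid a -> gsupp a \subset [set i] -> a = corner i.
Proof.
move=> aN a_sub; apply: coord_inj => l; rewrite coord_corner.
case: eqP => [->|/eqP li]; last by rewrite (coord_out a_sub) // inE.
by rewrite -[RHS](on_grid_sum aN a_sub) big_set1.
Qed.

(* Walk from a to the corner i along the steps a + e_i - e_j. *)
Lemma primitive_unique phi t t' f f' a i : primitive_on phi t f -> primitive_on phi t' f' ->
    on_grid a -> i |: gsupp a \in K -> i |: gsupp a \subset t -> i |: gsupp a \subset t' ->
  f a + f (corner i) = f' a + f' (corner i).
Proof.
move=> f_prim f'_prim.
have [m] := ubnP (N - coord a i)%N; elim: m a => // m IHm a am aN aK at_ at'.
have [/(corner_eq aN) -> |/subsetPn[j]] := boolP (gsupp a \subset [set i]).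
  by rewrite !F2_addxx.
rewrite in_set1 eq_sym => ja ij; have aj : (0 < coord a j)%N by rewrite inE in ja.
pose b := shift i j a; have b_sub : gsupp b \subset i |: gsupp a := gsupp_shift ij aN aj.
have ib_sub : i |: gsupp b \subset i |: gsupp a by rewrite subUset b_sub sub1set setU11.
have abE : [set a; b] \in edges_of T.
  apply: (grid_edge N_gt0 K_surface aK) => //; first exact: on_grid_shift.
  - exact: subsetUr.
  - exact: gclose_shift.
  - by rewrite eq_sym shift_neq.
have step r h : primitive_on phi r h -> i |: gsupp a \subset r -> h a = phi [set a; b] + h b.
  move=> h_prim ar; rewrite (h_prim a b) // -?addrA ?F2_addxx ?addr0 //.
    exact: subset_trans (subsetUr _ _) ar.
  exact: subset_trans b_sub ar.
rewrite (step _ _ f_prim) // (step _ _ f'_prim) // -!addrA; congr (_ + _); apply: IHm.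
- by have := on_grid_le2 aN ij; move: am; rewrite coord_shift_to //; clear -aj; lia.
- exact: on_grid_shift.
- by apply: surface_face ib_sub aK => //; apply/set0Pn; exists i; exact: setU11.
- exact: subset_trans at_.
- exact: subset_trans at'.
Qed.

Definition some_triangle s := odflt set0 [pick t in triangles_of K | s \subset t].

Lemma some_triangleP s t : t \in triangles_of K -> s \subset t ->
  some_triangle s \in triangles_of K /\ s \subset some_triangle s.
Proof.
move=> tT st; rewrite /some_triangle; case: pickP => [r /andP[rT sr]|/(_ t)] //=.
by rewrite tT st.
Qed.

(* The restriction to K of a cochain with local primitives f. *)
Definition coarse (f : {set 'I_n} -> gpoint n N -> F2) : {ffun {set 'I_n} -> F2} :=
  [ffun s : {set 'I_n} =>
    if s \in edges_of K then \sum_(i in s) f (some_triangle s) (corner i) else 0].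

Lemma coarseB f f' : coarse (fun t a => f t a - f' t a) = coarse f - coarse f'.
Proof.
by apply/ffunP => s; rewrite !ffunE; case: ifP => _; rewrite ?subr0 // -sumrB.
Qed.

Section Coarse.
Variables (phi : {ffun {set gpoint n N} -> F2}) (f : {set 'I_n} -> gpoint n N -> F2).
Hypothesis f_prim : forall t, t \in triangles_of K -> primitive_on phi t (f t).

Lemma local_primitives_agree t t' a i :
    t \in triangles_of K -> t' \in triangles_of K -> on_grid a ->
    i |: gsupp a \subset t -> i |: gsupp a \subset t' ->
  f t a + f t (corner i) = f t' a + f t' (corner i).
Proof.
move=> tT t'T aN at_ at'.
apply: (primitive_unique (f_prim tT) (f_prim t'T)) => //; have /setIdP[tK _] := tT.
by apply: surface_face at_ tK => //; apply/set0Pn; exists i; exact: setU11.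
Qed.

Lemma coarseE t i j : t \in triangles_of K -> [set i; j] \in edges_of K -> [set i; j] \subset t ->
  coarse f [set i; j] = f t (corner i) + f t (corner j).
Proof.
move=> tT ijE ijt; have [rT ijr] := some_triangleP tT ijt.
rewrite ffunE ijE big_setU1 ?inE ?(edge_neq K_two_sided) //= big_set1.
rewrite addrC [RHS]addrC; apply: local_primitives_agree; rewrite ?gsupp_corner //.
exact: on_grid_corner.
Qed.

Lemma coarse_cocycle : coarse f \in cocycles (edges_of K) (triangles_of K).
Proof.
apply/setIdP; split; first by apply/supp_inP => s sE; rewrite ffunE (negPf sE).
apply/eqP/ffunP => t; rewrite [RHS]ffunE.
have [tT|tT] := boolP (t \in triangles_of K); last first.
  by rewrite ffunE (negPf tT).
pose values : {ffun 'I_n -> F2} := [ffun i => f t (corner i)].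
transitivity (cob1 (edges_of K) (triangles_of K) (cob0 (edges_of K) values) t); last first.
  by rewrite (cob1_cob0 K_two_sided) ffunE.
rewrite [LHS]ffunE [RHS]ffunE tT; apply: eq_bigr => s /andP[sE st].
have [i [j sij]] := edgeP K_two_sided sE; subst s.
by rewrite (coarseE tT) // (cob0_pair K_two_sided) // !ffunE.
Qed.

(* If the restriction is the coboundary of g, normalize the primitives to take
   the value g i at the corner i: they then agree on common points. *)
Lemma coarse_coboundary : phi \in cocycles (edges_of T) (triangles_of T) ->
  coarse f \in coboundaries (edges_of K) -> phi \in coboundaries (edges_of T).
Proof.
move=> /setIdP[/supp_inP phiE _] /imsetP[g _ coarse_g].
pose offset t i := f t (corner i) + g i.
have offset_const t : t \in triangles_of K -> {in t &, forall i j, offset t i = offset t j}.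
  move=> tT i j it jt; have [->//|ij] := eqVneq i j.
  have ijt : [set i; j] \subset t by rewrite subUset !sub1set it.
  have ijE : [set i; j] \in edges_of K.
    by apply: (triangle_edge K_two_sided tT ijt); rewrite cards2 ij.
  have := coarseE tT ijE ijt; rewrite coarse_g (cob0_pair K_two_sided) // => gij.
  apply/eqP; rewrite -subr_eq0 F2_opp addrACA -gij.
  by rewrite addrACA !F2_addxx.
have on_common t t' a i :
    t \in triangles_of K -> t' \in triangles_of K -> on_grid a ->
    i \in gsupp a -> gsupp a \subset t -> gsupp a \subset t' ->
      f t a + offset t i = f t' a + offset t' i.
  move=> tT t'T aN ia at_ at'; rewrite /offset !addrA; congr (_ + _).
  by apply: local_primitives_agree; rewrite // (setUidPr _) // sub1set.
pose F := [ffun a => let t := some_triangle (gsupp a) in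
  f t a + odflt 0 (omap (offset t) [pick i in gsupp a])].
have FE t a i : t \in triangles_of K -> on_grid a -> gsupp a \subset t -> i \in t ->
    F a = f t a + offset t i.
  move=> tT aN at_ it; have [rT ar] := some_triangleP tT at_; rewrite ffunE /=.
  case: pickP => [l la|]; last first.
    by have /set0Pn[l la] := on_grid_supp N_gt0 aN; move/(_ l); rewrite la.
  rewrite /= (on_common _ t) //; congr (_ + _).
  by apply: offset_const => //; exact: (subsetP at_).
apply/imsetP; exists F => //; apply/ffunP => e.
have [eE|eE] := boolP (e \in edges_of T); last first.
  by rewrite phiE // ffunE (negPf eE).
have [a [b ab]] := edgeP T_two_sided eE; subst e.
have [_ aN bN _ [t tT [at_ bt]]] := grid_edgeP K_surface eE.
have /set0Pn[i ia] := on_grid_supp N_gt0 aN; have it : i \in t by exact: (subsetP at_).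
rewrite (cob0_pair T_two_sided) // (FE t a i) // (FE t b i) // (f_prim tT eE) //.
by rewrite addrACA F2_addxx addr0.
Qed.

End Coarse.

Lemma primitive_onB phi psi t f f' : primitive_on phi t f -> primitive_on psi t f' ->
  primitive_on (phi - psi) t (fun a => f a - f' a).
Proof.
move=> f_prim f'_prim a b abE at_ bt; rewrite !ffunE (f_prim a b) // (f'_prim a b) //.
by rewrite opprD addrACA.
Qed.

Lemma grid_H1_card_le2 : H1_card_le2 (edges_of K) (triangles_of K) ->
  H1_card_le2 (edges_of T) (triangles_of T).
Proof.
move=> H1_K; apply/(H1_card_le2P T_two_sided) => phi psi phiZ psiZ.
have [_ cocyclesB] := cocycles_zmod_closed (edges_of T) (triangles_of T).
have [f f_prim] := local_primitives phiZ; have [f' f'_prim] := local_primitives psiZ.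
have := (H1_card_le2P K_two_sided).1 H1_K _ _ (coarse_cocycle f_prim) (coarse_cocycle f'_prim).
case/or3P => cob; apply/or3P; [constructor 1|constructor 2|constructor 3].
- exact: coarse_coboundary f_prim phiZ cob.
- exact: coarse_coboundary f'_prim psiZ cob.
rewrite -coarseB in cob; apply: coarse_coboundary cob; last exact: cocyclesB.
by move=> t tT; apply: primitive_onB; [exact: f_prim|exact: f'_prim].
Qed.

End GridCohomology.

(** * Minors from connected vertex sets *)

Section ConnectedSetsMinor.
Variables (W V I : finType) (E : {set {set W}}) (core : V -> {set W}) (link : I -> {set W}).
Variables (tail head : I -> V).
Hypothesis tail_head : forall e, tail e != head e.
Hypothesis core_conn : forall v, connected_in E (core v).
Hypothesis core_inj : forall v w x, x \in core v -> x \in core w -> v = w.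
Hypothesis link_conn : forall e, connected_in E (link e).
Hypothesis link_tail : forall e, exists2 x, x \in link e & x \in core (tail e).
Hypothesis link_head : forall e, exists2 x, x \in link e & x \in core (head e).
Hypothesis link_core : forall e v x, x \in link e -> x \in core v -> v = tail e \/ v = head e.
Hypothesis link_inj : forall e f x, x \in link e -> x \in link f -> e = f.
Implicit Types (e f : I) (u v w : V) (x y z : W).

Definition open_link e := link e :\: core (head e).

(* The part of the link that can be reached from the tail before entering the core of the head. *)
Definition tail_part e := [set w in open_link e |
  [exists x in core (tail e) :&: open_link e, connect (adj_in E (open_link e)) x w]].

Definition branch v := core v :|: \bigcup_(e | tail e == v) tail_part e.

Lemma tail_part_sub_branch e : tail_part e \subset branch (tail e).
Proof. by apply: subset_trans (subsetUr _ _); exact: bigcup_sup. Qed.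

Lemma tail_part_link e x : x \in tail_part e -> x \in link e /\ x \notin core (head e).
Proof. by case/setIdP => /setDP. Qed.

Lemma branch_inj v w x : x \in branch v -> x \in branch w -> v = w.
Proof.
have tail_part_core e u : x \in tail_part e -> x \in core u -> u = tail e.
  case/tail_part_link => xe xh xu; have [//|uh] := link_core xe xu.
  by rewrite -uh xu in xh.
case/setUP=> [xv|/bigcupP[e /eqP <- xe]] /setUP[xw|/bigcupP[f /eqP <- xf]].
- exact: core_inj xv xw.
- exact: tail_part_core xf xv.
- by rewrite (tail_part_core e w).
- have [xe' _] := tail_part_link xe; have [xf' _] := tail_part_link xf.
  by rewrite (link_inj xe' xf').
Qed.

Lemma tail_part_step e x y : x \in tail_part e -> y \in open_link e -> [set x; y] \in E ->
  y \in tail_part e.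
Proof.
case/setIdP => xe /exists_inP[z z_tail zx] ye xyE.
apply/setIdP; split=> //; apply/exists_inP; exists z => //; apply: connect_trans zx _.
by apply: connect1; rewrite /adj_in /= xe ye.
Qed.

Lemma tail_part_connected e z : z \in tail_part e ->
  exists2 x, x \in core (tail e) & connect (adj_in E (branch (tail e))) x z.
Proof.
case/setIdP => _ /exists_inP[x /setIP[x_tail xe]].
have x_part : x \in tail_part e.
  by apply/setIdP; split=> //; apply/exists_inP; exists x; [exact/setIP|exact: connect0].
case/connectP => p pth ->; exists x => //; have part_branch := subsetP (tail_part_sub_branch e).
elim: p x x_part pth {x_tail xe} => [|y p IHp] x x_part /=; first by rewrite connect0.
case/andP => /and3P[xe ye xyE] pth; have y_part := tail_part_step x_part ye xyE.
apply: connect_trans (IHp y y_part pth); apply: connect1.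
by rewrite /adj_in /= !part_branch.
Qed.

Lemma branch_connected v : connected_in E (branch v).
Proof.
have to_core x : x \in branch v -> exists2 z, z \in core v & connect (adj_in E (branch v)) z x.
  case/setUP => [x_core|/bigcupP[e /eqP <-]]; first by exists x.
  exact: tail_part_connected.
move=> x y /to_core[x' x'_core x'x] /to_core[y' y'_core y'y].
rewrite adj_in_sym; apply: connect_trans x'x; rewrite adj_in_sym; apply: connect_trans y'y.
by apply: connect_adj_in_sub (core_conn x'_core y'_core); exact: subsetUl.
Qed.

Lemma branch_edge e : exists x y,
  [/\ [set x; y] \in E, x \in branch (tail e) & y \in branch (head e)].
Proof.
have [p pe p_tail] := link_tail e; have [q qe q_head] := link_head e.
have p_part : p \in tail_part e.
  have p_open : p \in open_link e.
    by rewrite inE pe andbT; apply: contra (tail_head e) => /(core_inj p_tail) ->.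
  by apply/setIdP; split=> //; apply/exists_inP; exists p; [exact/setIP|exact: connect0].
have /connectP[s] := link_conn pe qe.
elim: s p p_part {pe p_tail} => [|z s IHs] p p_part /=.
  by move=> _ qp; have [_] := tail_part_link p_part; rewrite -qp q_head.
case/andP => /and3P[_ ze pzE] pth q_last; have [z_head|z_head] := boolP (z \in core (head e)).
  by exists p, z; split; rewrite ?(subsetP (tail_part_sub_branch e)) // inE z_head.
by apply: IHs pth q_last; apply: tail_part_step p_part _ pzE; rewrite inE z_head.
Qed.

Lemma connected_sets_minor (A : {set {set V}}) :
    (forall a, a \in A -> exists e, a = [set tail e; head e]) ->
  minor_model E A (fun x => [pick v | x \in branch v]).
Proof.
set beta := fun x => _; move=> A_ends.
have betaE x v : (beta x == Some v) = (x \in branch v).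
  rewrite /beta; case: pickP => [u xu|/(_ v) ->] //.
  by apply/eqP/idP => [[<-]|/(branch_inj xu) ->].
split=> [v|_ /A_ends[e ->]].
  have -> : branch_set beta v = branch v by apply/setP => x; rewrite inE betaE.
  exact: branch_connected.
have [x [y [xyE x_tail y_head]]] := branch_edge e.
by exists [set x; y], x, y, (tail e), (head e); split=> //; apply/eqP; rewrite betaE.
Qed.

End ConnectedSetsMinor.

(** * Greedy labellings *)

Section Greedy.
Variables (T : finType) (gap : T -> T -> nat) (L : T -> {fset int}).
Hypothesis gapC : commutative gap.
Implicit Types (c : T -> int) (Z : {set T}) (x y : T).

(* Outside Z the values of c are irrelevant. *)
Definition partial_labelling Z c := (forall x, c x \in L x) /\
  {in Z &, forall x y, x != y -> (gap x y)%:Z <= `|c x - c y|}.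

Definition near_labels (k : nat) (z : int) : seq int :=
  [seq z + i%:Z - k.-1%:Z | i <- iota 0 (2 * k).-1].

Lemma mem_near_labels k z w : `|w - z| < k%:Z -> w \in near_labels k z.
Proof.
move=> wz; apply/mapP; exists (absz (w - z + k.-1%:Z)); first by rewrite mem_iota; lia.
by lia.
Qed.

Lemma fset_avoid (K : choiceType) (s : {fset K}) (t : seq K) :
  (size t < #|` s|)%N -> exists2 z, z \in s & z \notin t.
Proof.
move=> ts; have [/allP sub|/allPn[z zs zt]] := boolP (all (mem t) s); last by exists z.
by have := uniq_leq_size (fset_uniq s) sub; rewrite leqNgt ts.
Qed.

Lemma greedy_extend Z c x : partial_labelling Z c ->
    (\sum_(y in Z) (2 * gap x y).-1 < #|` L x|)%N ->
  exists c', partial_labelling (x |: Z) c'.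
Proof.
move=> [cL cZ] size_lt; pose t := flatten [seq near_labels (gap x y) (c y) | y <- enum Z].
have [|z zL zt] := @fset_avoid _ (L x) t.
  rewrite size_flatten /shape -map_comp sumnE big_map big_enum /=.
  by rewrite (eq_bigr (fun y => (2 * gap x y).-1)) // => y _; rewrite size_map size_iota.
have z_far y : y \in Z -> (gap x y)%:Z <= `|z - c y|.
  move=> yZ; rewrite leNgt; apply: contra zt => /mem_near_labels z_near.
  apply/flattenP; exists (near_labels (gap x y) (c y)) => //.
  by apply/mapP; exists y; rewrite ?mem_enum.
exists (fun y => if y == x then z else c y); split=> [y|y w]; first by case: eqP => [->|].
rewrite !in_setU1; have [->|yx] := eqVneq y x; have [->|wx] := eqVneq w x; rewrite ?eqxx //=.
- by move=> _ /z_far.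
- by move=> /z_far + _ _; rewrite distrC gapC.
- by move=> yZ wZ; exact: cZ.
Qed.

End Greedy.

Lemma sub_partial_labelling (T : finType) (gap gap' : T -> T -> nat) (L : T -> {fset int})
    (Z Z' : {set T}) (c : T -> int) :
    Z' \subset Z -> {in Z' &, forall x y, gap' x y <= gap x y}%N ->
  partial_labelling gap L Z c -> partial_labelling gap' L Z' c.
Proof.
move=> /subsetP Z'Z gap_le [cL cZ]; split=> // x y xZ yZ xy.
by apply: le_trans (cZ x y (Z'Z _ xZ) (Z'Z _ yZ) xy); rewrite lez_nat gap_le.
Qed.

Lemma edge_set_card (G : sgraph) (e : {set G}) : e \in edge_set G -> #|e| = 2%N.
Proof.
case/imsetP => -[u v] /=; rewrite inE /= => uv ->; rewrite cards2.
by case: eqP uv => // ->; rewrite adj_irr.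
Qed.

Lemma mem_edge_set (G : sgraph) (u v : G) : ([set u; v] \in edge_set G) = adj u v.
Proof.
apply/imsetP/idP => [[[x y]]|uv]; last by exists (u, v).
rewrite inE /= => xy uvE; have /setP sub := uvE.
move: (sub u) (sub v) (sub y) (sub x); rewrite !inE !eqxx !orbT.
case/esym/orP => /eqP ->; case/esym/orP => /eqP -> //.
- by case/orP => /eqP xy'; rewrite xy' adj_irr in xy.
- by rewrite adj_sym.
- by move=> _ /orP[] /eqP xy'; rewrite xy' adj_irr in xy.
Qed.

Section GraphGap.
Variables (d : nat) (G : sgraph).
Implicit Types (A B : {set edge G}) (X : {set G}) (e f : edge G) (u v w : G) (x y : element G).

Definition total_gap A x y : nat :=
  match x, y with
  | inl u, inl v => [set u; v] \in val @: A
  | inr e, inr f => val e :&: val f != set0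
  | inl u, inr e | inr e, inl u => d * (u \in val e)
  end.

Lemma total_gapC A : commutative (total_gap A).
Proof. by move=> [u|e] [v|f] //=; rewrite setUC || rewrite setIC. Qed.

Definition elements X B : {set element G} :=
  [set x | match x with inl u => u \in X | inr e => e \in B end].

Definition deg A v := degree val A v.

Lemma deg_lt A B e v : B \subset A -> e \in A -> e \notin B ->
  v \in val e -> (deg B v < deg A v)%N.
Proof.
move=> /subsetP BA eA eB ve; apply/proper_card/properP; split.
  by apply/subsetP => f /setIdP[/BA fA vf]; exact/setIdP.
by exists e; [exact/setIdP|apply: contra eB => /setIdP[]].
Qed.

Lemma val_edge_card A (s : {set G}) : s \in val @: A -> #|s| = 2%N.
Proof. by case/imsetP => f _ ->; exact: edge_set_card (valP f). Qed.

Lemma degree_val_imset A v : degree id (val @: A) v = deg A v.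
Proof.
rewrite /deg /degree -[RHS](card_imset _ val_inj); apply: eq_card => s; rewrite inE.
apply/andP/imsetP => [[/imsetP[f fA ->] vf]|[f /setIdP[fA vf] ->]]; last by rewrite imset_f.
by exists f => //; exact/setIdP.
Qed.

Lemma sum_gap_vertex A X B u :
  (\sum_(y in elements X B) (2 * total_gap A (inl u) y).-1 <= deg A u + (2 * d).-1 * deg B u)%N.
Proof.
rewrite big_sumType /=; apply: leq_add.
  rewrite -degree_val_imset -(card_neighbours (@val_edge_card A)).
  rewrite -sum1_card big_mkcond [leqRHS]big_mkcond.
  by apply: leq_sum => v _; rewrite !inE; case: (_ \in X); case: (_ \in val @: A).
rewrite mulnC -sum_nat_const big_mkcond [leqRHS]big_mkcond; apply: leq_sum => e _.
by rewrite !inE; case: (e \in B); case: (u \in val e); rewrite ?muln0 ?muln1.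
Qed.

Lemma sum_gap_edge A X B e u v : val e = [set u; v] ->
  (\sum_(y in elements X B) (2 * total_gap A (inr e) y).-1 <=
   deg B u + deg B v + (2 * d).-1 * ((u \in X) + (v \in X)))%N.
Proof.
move=> ev; have uv : u != v by have := edge_set_card (valP e); rewrite ev cards2; case: eqP.
rewrite big_sumType /= addnC; apply: leq_add.
  apply: leq_trans (leq_card_setU _ _); rewrite -sum1_card big_mkcond [leqRHS]big_mkcond.
  apply: leq_sum => f _; rewrite [_ \in elements _ _]inE; case: (boolP (f \in B)) => // fB.
  case: (boolP (_ == set0)) => // /set0Pn[w]; rewrite in_setI ev in_set2 => /andP[wuv wf].
  by rewrite in_setU !inE fB; case/orP: wuv => /eqP <-; rewrite wf ?orbT.
rewrite ev (bigID (mem [set u; v])) /= [X in (_ + X)%N]big1 ?addn0.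
  2: by move=> w /andP[_ /negPf ->]; rewrite muln0.
under eq_bigl do rewrite andbC.
rewrite big_mkcondr big_setU1 ?inE //= big_set1 !inE !eqxx orbT muln1 mulnDr.
by case: (u \in X); case: (v \in X); rewrite ?muln1 ?muln0.
Qed.

End GraphGap.

Section Reductions.
Variables (d M : nat) (G : sgraph) (L : element G -> {fset int}).
Hypothesis d_gt0 : (0 < d)%N.
Hypothesis L_card : forall x, #|` L x| = (M + 2 * d)%N.
Implicit Types (A B Q : {set edge G}) (X : {set G}) (e f : edge G) (u v w : G).

(* A proper labelling, in the graph with edge set A, of the vertices in X and the edges in B. *)
Definition labelled A X B := exists c, partial_labelling (total_gap d A) L (elements X B) c.

Definition edge_weight A e := (\sum_(v in val e) deg A v)%N.

Lemma edge_ends e : exists u v, val e = [set u; v] /\ u != v.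
Proof.
by have /eqP/cards2P[u [v [uv ev]]] := edge_set_card (valP e); exists u, v.
Qed.

Lemma edge_weightE A e u v : val e = [set u; v] -> edge_weight A e = (deg A u + deg A v)%N.
Proof.
move=> ev; have uv : u != v by have := edge_set_card (valP e); rewrite ev cards2; case: eqP.
by rewrite /edge_weight ev big_setU1 ?inE //= big_set1.
Qed.

Lemma labelled_add_vertex A X B u : labelled A X B ->
  (deg A u + (2 * d).-1 * deg B u < M + 2 * d)%N -> labelled A (u |: X) B.
Proof.
case=> c cP size_lt; have [|c' c'P] := greedy_extend (@total_gapC d G A) (x := inl u) cP.
  by rewrite L_card; apply: leq_ltn_trans size_lt; exact: sum_gap_vertex.
exists c'; rewrite (_ : elements _ _ = inl u |: elements X B) //.
by apply/setP => -[v|e]; rewrite !inE.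
Qed.

Lemma labelled_add_edge A X B e u v : labelled A X B -> val e = [set u; v] ->
  (deg B u + deg B v + (2 * d).-1 * ((u \in X) + (v \in X)) < M + 2 * d)%N ->
  labelled A X (e |: B).
Proof.
case=> c cP ev size_lt; have [|c' c'P] := greedy_extend (@total_gapC d G A) (x := inr e) cP.
  by rewrite L_card; apply: leq_ltn_trans size_lt; exact: sum_gap_edge ev.
exists c'; rewrite (_ : elements _ _ = inr e |: elements X B) //.
by apply/setP => -[v'|f]; rewrite !inE.
Qed.

(* Uncolouring an end of e removes the only new constraint between vertices. *)
Lemma labelled_uncolour A X B e u : labelled (A :\ e) setT (A :\ e) -> B \subset A :\ e ->
  u \in val e -> u \notin X -> labelled A X B.
Proof.
case=> c cP BA ue uX; exists c; apply: sub_partial_labelling cP.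
  by apply/subsetP => -[v|f]; rewrite !inE // => /(subsetP BA); rewrite !inE.
move=> [v|f] [w|f']; rewrite ?inE //= => vX wX; case: imsetP => // -[f fA vw].
rewrite lt0b; apply/imsetP; exists f => //; rewrite in_setD1 fA andbT.
apply: contraNneq uX => fe; have : u \in [set v; w] by rewrite vw fe.
by rewrite in_set2 => /orP[] /eqP ->.
Qed.

Lemma labelled_degree_le3 A e u v : e \in A -> val e = [set u; v] ->
  labelled (A :\ e) setT (A :\ e) -> (4 * d < M)%N -> (deg A u <= 3)%N ->
  (deg A u + deg A v <= M + 2)%N -> labelled A setT A.
Proof.
move=> eA ev IH dM u3 uvM; have ue : u \in val e by rewrite ev set21.
have ve : v \in val e by rewrite ev set22.
have sub := subD1set A e; have eN : e \notin A :\ e by rewrite !inE eqxx.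
have e_labelled : labelled A [set~ u] A.
  rewrite -[X in labelled _ _ X](setD1K eA); apply: (labelled_add_edge _ ev).
    by apply: (labelled_uncolour IH (subxx _) ue); rewrite !inE eqxx.
  have := deg_lt sub eA eN ue; have := deg_lt sub eA eN ve.
  move: uvM; rewrite !inE eqxx /=; move: (deg (A :\ e) u) (deg (A :\ e) v) (deg A u) (deg A v).
  by case: (v != u); clear -d_gt0; lia.
rewrite (_ : setT = u |: [set~ u]); last by apply/setP => w; rewrite !inE orbN.
apply: labelled_add_vertex e_labelled _.
have : ((2 * d).-1 * deg A u <= (2 * d).-1 * 3)%N by rewrite leq_mul2l u3 orbT.
by clear -d_gt0 u3 dM; lia.
Qed.

Lemma labelled_add_edges A B : labelled A setT B -> B \subset A ->
  (forall e, e \in A :\: B -> (edge_weight A e + 2 * d <= M + 3)%N) -> labelled A setT A.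
Proof.
have [n] := ubnP #|A :\: B|; elim: n B => // n IHn B n_gt B_lab BA light.
have [AB0|/set0Pn[e eAB]] := eqVneq (A :\: B) set0.
  have AB : B = A by apply/eqP; rewrite eqEsubset BA -setD_eq0 AB0 eqxx.
  by rewrite AB in B_lab.
have /setDP[eA eB] := eAB; have [u [v [ev _]]] := edge_ends e.
have ue : u \in val e by rewrite ev set21.
have ve : v \in val e by rewrite ev set22.
have sub f : f \in A :\: (e |: B) -> f \in A :\: B.
  by rewrite !inE negb_or -andbA => /and3P[_ -> ->].
apply: (IHn (e |: B)) => [|||f /sub].
- rewrite -ltnS; apply: leq_trans n_gt; rewrite ltnS; apply: proper_card.
  apply/properP; split; first by apply/subsetP => f /sub.
  by exists e => //; rewrite !inE eqxx.
- apply: (labelled_add_edge B_lab ev).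
  have := light e eAB; rewrite (edge_weightE A ev) !inE muln2.
  have := deg_lt BA eA eB ue; have := deg_lt BA eA eB ve.
  by clear -d_gt0; lia.
- by rewrite subUset sub1set eA.
- exact: light.
Qed.

Lemma labelled_relabel A e u Q : labelled (A :\ e) setT (A :\ e) -> e \in Q -> Q \subset A ->
    u \in val e -> (deg (A :\: Q) u <= 3)%N -> (deg A u + 4 * d <= M + 2)%N ->
  (forall f, f \in Q -> (edge_weight A f + 2 * d <= M + 3)%N) -> labelled A setT A.
Proof.
move=> IH eQ QA ue u3 uM light; apply: (@labelled_add_edges A (A :\: Q)).
- rewrite (_ : setT = u |: [set~ u]); last by apply/setP => w; rewrite !inE orbN.
  apply: labelled_add_vertex.
    apply: (labelled_uncolour IH _ ue); last by rewrite !inE eqxx.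
    by apply: setDS; rewrite sub1set.
  have : ((2 * d).-1 * deg (A :\: Q) u <= (2 * d).-1 * 3)%N by rewrite leq_mul2l u3 orbT.
  by clear -d_gt0 uM; lia.
- exact: subsetDl.
- by move=> f; rewrite setDDr setDv set0U => /setIP[_ /light].
Qed.

End Reductions.

(** * Discharging *)

Lemma deg_le_max_degree (G : sgraph) (A : {set edge G}) (v : G) : (deg A v <= max_degree G)%N.
Proof.
rewrite -degree_val_imset -(card_neighbours (@val_edge_card _ A)).
apply: leq_trans (leq_bigmax (F := fun v : G => #|[pred w | adj v w]|) v).
apply/subset_leq_card/subsetP => w; rewrite inE => /imsetP[e _ vwE].
by rewrite inE -mem_edge_set vwE; exact: valP.
Qed.

Section Discharging.
Variable G : sgraph.
Implicit Types (A : {set edge G}) (X Y : {set G}) (e f : edge G) (u v w : G).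
Hypothesis G_sparse : forall B : {set {set G}}, B \subset edge_set G -> sparse_edges B.

Definition covered A := [set v | (0 < deg A v)%N].

Lemma cover_val_imset A : cover (val @: A) = covered A.
Proof.
apply/setP => v; rewrite [RHS]inE.
apply/bigcupP/card_gt0P => [[s /imsetP[e eA ->] ve]|[e /setIdP[eA ve]]].
  by exists e; exact/setIdP.
by exists (val e) => //; exact: imset_f.
Qed.

Lemma edge_sparse A : A != set0 -> (#|A| + 3 <= 3 * #|covered A|)%N /\
  (forall X, bipartite_edges (val @: A) X -> (#|A| + 2 <= 2 * #|covered A|)%N).
Proof.
move=> A_neq0; rewrite -cover_val_imset -(card_imset _ val_inj); apply: G_sparse.
  by apply/subsetP => s /imsetP[e _ ->]; exact: valP.
by have /set0Pn[e eA] := A_neq0; apply/set0Pn; exists (val e); exact: imset_f.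
Qed.

Definition cross A X Y := [set e in A | (val e :&: X != set0) && (val e :&: Y != set0)].

Lemma cross_ends A X Y e : [disjoint X & Y] -> e \in cross A X Y ->
  exists x y, [/\ val e = [set x; y], x \in X & y \in Y].
Proof.
move=> XY /setIdP[_ /andP[/set0Pn[x /setIP[xe xX]] /set0Pn[y /setIP[ye yY]]]].
exists x, y; split=> //; apply/esym/eqP; rewrite eqEcard subUset !sub1set xe ye.
rewrite (edge_set_card (valP e)) cards2; case: eqP => // xy.
by have := disjointFr XY xX; rewrite xy yY.
Qed.

Lemma cross_bipartite A X Y : [disjoint X & Y] -> bipartite_edges (val @: cross A X Y) X.
Proof.
move=> XY u v /imsetP[e eC uvE]; have [x [y [exy xX yY]]] := cross_ends XY eC.
have yX := disjointFl XY yY.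
have uv : u != v by have := edge_set_card (valP e); rewrite -uvE cards2; case: eqP.
have : u \in [set x; y] by rewrite -exy -uvE set21.
have : v \in [set x; y] by rewrite -exy -uvE set22.
move: uv; rewrite !in_set2.
move=> uv /orP[] /eqP vE /orP[] /eqP uE; subst u v; rewrite ?eqxx // in uv *.
  by rewrite xX yX.
by rewrite xX yX.
Qed.

Lemma cross_bound A X Y : [disjoint X & Y] ->
  (\sum_(x in X) deg (cross A X Y) x <= 2 * (#|X| + #|Y|))%N.
Proof.
move=> XY; rewrite sum_degree.
have -> : (\sum_(e in cross A X Y) #|val e :&: X| = #|cross A X Y|)%N.
  rewrite -sum1_card; apply: eq_bigr => e /(cross_ends XY)[x [y [-> xX yY]]].
  rewrite setIUl (setIidPl _) ?sub1set // (_ : [set y] :&: X = set0) ?setU0 ?cards1 //.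
  by apply/setP => z; rewrite !inE; case: eqP => // ->; rewrite (disjointFl XY yY).
have [->|C_neq0] := eqVneq (cross A X Y) set0; first by rewrite cards0.
have [_ /(_ X (cross_bipartite (A := A) XY)) bound] := edge_sparse C_neq0.
apply: leq_trans (leq_addr 2 _) (leq_trans bound _); rewrite leq_mul2l /=.
apply: leq_trans (leq_card_setU _ _); apply/subset_leq_card/subsetP => v.
rewrite inE => /card_gt0P[e]; case/setIdP => /(cross_ends XY)[x [y [-> xX yY]]].
by rewrite in_set2 in_setU => /orP[] /eqP ->; rewrite ?xX ?yY ?orbT.
Qed.

Lemma edge_endE e u : u \in val e -> exists v, val e = [set u; v].
Proof.
have [x [y [-> _]]] := edge_ends e; rewrite in_set2 => /orP[] /eqP ->; first by exists y.
by exists x; rewrite setUC.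
Qed.

Section Irreducible.
Variables (A : {set edge G}) (M d : nat).
Hypotheses (d_ge2 : (2 <= d)%N) (M_ge : (5 * d + 2 <= M)%N) (A_neq0 : A != set0).
Hypothesis deg_le : forall v, (deg A v <= M)%N.

Definition heavy := [set e in A | (M + 4 <= edge_weight A e + 2 * d)%N].
Definition low k := [set v | (0 < deg A v <= k)%N].
Definition high m := [set v | (m <= deg A v)%N].

Hypothesis low3_neighbours : forall e u v, e \in A -> val e = [set u; v] -> (deg A u <= 3)%N ->
  (M + 3 <= deg A u + deg A v)%N.
Hypothesis deg45_heavy : forall u, (3 < deg A u <= 5)%N -> (4 <= deg heavy u)%N.

Lemma deg_ge3 u : (0 < deg A u)%N -> (3 <= deg A u)%N.
Proof.
move=> u_gt0; rewrite leqNgt; apply/negP => u_lt3.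
have /card_gt0P[e /setIdP[eA /edge_endE[v ev]]] := u_gt0.
have := low3_neighbours eA ev (ltnW u_lt3); have := deg_le v.
by move: (deg A u) (deg A v) u_lt3 => a b; clear; lia.
Qed.

Lemma deg_heavy u : (0 < deg A u <= 5)%N -> (minn 4 (deg A u) <= deg heavy u)%N.
Proof.
move=> /andP[u_gt0 u_le5]; have [u_le3|u_gt3] := leqP (deg A u) 3; last first.
  by rewrite geq_min deg45_heavy ?u_gt3.
rewrite geq_min; apply/orP; right; apply/subset_leq_card/subsetP => e /setIdP[eA ue].
have [v ev] := edge_endE ue; apply/setIdP; split=> //; apply/setIdP; split=> //.
rewrite (edge_weightE A ev); have := low3_neighbours eA ev u_le3.
by move: (deg A u) (deg A v) => a b; clear -d_ge2; lia.
Qed.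

Lemma heavy_end e u v : e \in heavy -> val e = [set u; v] ->
  [/\ (deg A u <= 3 -> M <= deg A v)%N, (deg A u <= 4 -> 8 <= deg A v)%N
    & (deg A u <= 5 -> 7 <= deg A v)%N].
Proof.
move=> /setIdP[eA + ev]; rewrite (edge_weightE A ev).
have := @low3_neighbours _ _ _ eA ev; move: (deg A u) (deg A v) => a b low3 weight.
split=> [a_le3| |]; first by have := low3 a_le3; clear -a_le3; lia.
  by clear -weight d_ge2 M_ge; lia.
by clear -weight d_ge2 M_ge; lia.
Qed.

Lemma low_high_bound k m : (k <= 5)%N -> (k < m)%N ->
    (forall e u v, e \in heavy -> val e = [set u; v] -> deg A u <= k -> m <= deg A v)%N ->
  (\sum_(u in low k) minn 4 (deg A u) <= 2 * (#|low k| + #|high m|))%N.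
Proof.
move=> k_le5 km heavy_high.
have disj : [disjoint low k & high m].
  apply/pred0P => v /=; rewrite !inE; apply/negbTE; rewrite negb_and -ltnNge.
  by have [/leq_ltn_trans->|_] := leqP (deg A v) k; rewrite ?orbT ?andbF.
apply: leq_trans (cross_bound heavy disj); apply: leq_sum => u u_low.
have /andP[u_gt0 u_le] : (0 < deg A u <= k)%N by rewrite inE in u_low.
apply: (@leq_trans (deg heavy u)); first by apply: deg_heavy; rewrite u_gt0 (leq_trans u_le).
apply/subset_leq_card/subsetP => e /setIdP[eH ue]; have [v ev] := edge_endE ue.
apply/setIdP; split=> //; apply/setIdP; split=> //; apply/andP; split; apply/set0Pn.
  by exists u; exact/setIP.
by exists v; rewrite ev !inE eqxx orbT; apply: heavy_high ev u_le.
Qed.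

Lemma sum_deg : (\sum_v deg A v = 2 * #|A|)%N.
Proof.
have := sum_degree val A [set: G]; rewrite big_mkcond (eq_bigr (deg A)) => [->|v _].
  2: by rewrite inE.
rewrite (eq_bigr (fun=> 2%N)) ?sum_nat_const 1?mulnC // => e _.
by rewrite setIT (edge_set_card (valP e)).
Qed.

(* Give v the charge 2 deg v - 12, negative only for degrees 3, 4 and 5: four times the
   bound for low 3, plus those for low 4 and low 5, pay for it from the high degrees. *)
Lemma no_irreducible_graph : False.
Proof.
have low3 : (\sum_(u in low 3) minn 4 (deg A u) <= 2 * (#|low 3| + #|high M|))%N.
  apply: low_high_bound => // [|e u v eH ev]; first by clear -M_ge d_ge2; lia.
  by have [] := heavy_end eH ev.
have low4 : (\sum_(u in low 4) minn 4 (deg A u) <= 2 * (#|low 4| + #|high 8|))%N.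
  by apply: low_high_bound => // e u v eH ev; have [] := heavy_end eH ev.
have low5 : (\sum_(u in low 5) minn 4 (deg A u) <= 2 * (#|low 5| + #|high 7|))%N.
  by apply: low_high_bound => // e u v eH ev; have [] := heavy_end eH ev.
have charge : (12 * #|covered A| + 8 * #|low 3| + 2 * #|low 4| + 2 * #|low 5| +
      8 * #|high M| + 2 * #|high 8| + 2 * #|high 7| <=
    2 * \sum_v deg A v + 4 * \sum_(u in low 3) minn 4 (deg A u) +
      \sum_(u in low 4) minn 4 (deg A u) + \sum_(u in low 5) minn 4 (deg A u))%N.
  have cardE (P : pred G) : #|[set v | P v]| = (\sum_v P v)%N.
    by rewrite -sum1dep_card big_mkcond; apply: eq_bigr => v _; case: (P v).
  have sumE k : (\sum_(u in low k) minn 4 (deg A u) =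
      \sum_u (0 < deg A u <= k) * minn 4 (deg A u))%N.
    rewrite big_mkcond; apply: eq_bigr => u _.
    by rewrite inE; case: (_ <= _ <= _)%N; rewrite ?mul1n ?mul0n.
  rewrite !cardE !sumE !big_distrr -!big_split /=; apply: leq_sum => v _.
  have M_ge12 : (12 <= M)%N by clear -d_ge2 M_ge; lia.
  have := @deg_ge3 v; move: (deg A v) => k; clear -M_ge12.
  by case: (leqP M k); case: k => [|[|[|[|[|[|[|[|k]]]]]]]] //=; lia.
have [tot _] := edge_sparse A_neq0; move: charge; rewrite sum_deg.
by clear -low3 low4 low5 tot; lia.
Qed.

End Irreducible.

End Discharging.

Lemma partial_labelling_total (d : nat) (G : sgraph) (L : element G -> {fset int})
    (c : element G -> int) :
  partial_labelling (total_gap d [set: edge G]) L [set: element G] c -> total_labelling d c.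
Proof.
case=> _ cP; have gap_le x y : x != y -> (total_gap d setT x y)%:Z <= `|c x - c y|.
  by apply: cP; exact: in_setT.
have gap1_neq x y : x != y -> total_gap d setT x y = 1%N -> c x <> c y.
  by move=> /gap_le + gap1 cxy; rewrite gap1 cxy subrr normr0.
split=> [u v uv|e f ef ef_meet|u e ue].
- apply: gap1_neq; first by apply: contraTneq uv => -[->]; rewrite adj_irr.
  have uvE : [set u; v] \in edge_set G by rewrite mem_edge_set.
  have uv_val : [set u; v] \in val @: [set: edge G].
    by apply/imsetP; exists (Sub [set u; v] uvE : edge G); rewrite ?in_setT ?SubK.
  by rewrite /= uv_val.
- by apply: gap1_neq; [apply: contraNneq ef => -[->]|rewrite /= ef_meet].
- by have := gap_le (inl u) (inr e) isT; rewrite /= ue muln1.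
Qed.

Lemma labelled_all (d : nat) (G : sgraph) (L : element G -> {fset int}) (A : {set edge G}) :
    (2 <= d)%N -> (5 * d + 2 <= max_degree G)%N ->
    (forall B : {set {set G}}, B \subset edge_set G -> sparse_edges B) ->
    (forall x, #|` L x| = (max_degree G + 2 * d)%N) ->
  labelled d L A [set: G] A.
Proof.
move=> d_ge2 M_ge G_sparse L_card.
have d_gt0 : (0 < d)%N by exact: ltnW.
have [n] := ubnP #|A|; elim: n A => // n IHn A A_lt; have [A0|A_neq0] := eqVneq A set0.
  have L_neq0 x : exists z, z \in L x.
    have [|z zL _] := @fset_avoid _ (L x) [::]; last by exists z.
    by rewrite L_card addn_gt0 muln_gt0 d_gt0 orbT.
  have [c cL] := fin_all_exists L_neq0; exists c; split=> //.
  by rewrite A0 => -[u|e] [v|f]; rewrite !inE //= imset0 inE.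
apply: contrapT => A_unlabelled.
have IH e : e \in A -> labelled d L (A :\ e) setT (A :\ e).
  move=> eA; apply: IHn; rewrite -ltnS; apply: leq_trans A_lt; rewrite ltnS.
  by rewrite [ltnRHS](cardsD1 e) eA.
apply: (no_irreducible_graph G_sparse d_ge2 M_ge A_neq0 (deg_le_max_degree A)).
- move=> e u v eA ev u_le3; rewrite leqNgt; apply/negP => uv_lt; apply: A_unlabelled.
  apply: (labelled_degree_le3 d_gt0 L_card eA ev (IH e eA)) => //; last first.
    by rewrite addnS ltnS in uv_lt.
  by clear -d_gt0 M_ge; lia.
- move=> u /andP[u_gt3 u_le5]; rewrite leqNgt; apply/negP => heavy_lt; apply: A_unlabelled.
  have heavy_sub : heavy A (max_degree G) d \subset A by apply/subsetP => e /setIdP[].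
  have /subsetPn[e /setIdP[eA ue] e_light] :
      ~~ ([set e in A | u \in val e] \subset [set e in heavy A (max_degree G) d | u \in val e]).
    by apply/negP => /subset_leq_card le; have := leq_ltn_trans le heavy_lt; rewrite ltnNge u_gt3.
  apply: (labelled_relabel d_gt0 L_card
    (u := u) (Q := A :\: heavy A (max_degree G) d) (IH e eA)) => //.
  + by rewrite inE eA andbT; apply: contra e_light => eH; exact/setIdP.
  + exact: subsetDl.
  + by rewrite setDDr setDv set0U (setIidPr heavy_sub).
  + by move: u_le5; clear -M_ge d_gt0; lia.
  + move=> f /setDP[fA]; rewrite inE fA /= -ltnNge => weight.
    by rewrite addnS ltnS in weight.
Qed.

Lemma sparse_total_choosability (d : nat) (G : sgraph) :
    (2 <= d)%N -> (5 * d + 2 <= max_degree G)%N ->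
    (forall B : {set {set G}}, B \subset edge_set G -> sparse_edges B) ->
  (total_choosability d G <= max_degree G + 2 * d)%N.
Proof.
move=> d_ge2 M_ge G_sparse; rewrite /total_choosability; case: ex_minnP => m _; apply.
apply/asboolP => L L_card; have [c cP] := labelled_all [set: edge G] d_ge2 M_ge G_sparse L_card.
have elementsT : elements [set: G] [set: edge G] = setT by apply/setP => -[u|e]; rewrite !inE.
rewrite elementsT in cP; exists c; first exact: partial_labelling_total cP.
by have [] := cP.
Qed.

(** * Embeddings *)

From mathcomp Require Import all_classical all_reals all_analysis.

Import numFieldNormedType.Exports.
Local Open Scope classical_set_scope.
Local Open Scope ring_scope.

(* Round down the partial sums. *)
Lemma integer_rounding (R : archiRealFieldType) (n N : nat) (x : 'I_n -> R) :
    (forall i, 0 <= x i) -> \sum_i x i = N%:R ->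
  exists p : 'I_n -> nat, (\sum_i p i = N)%N /\ forall i, `|x i - (p i)%:R| < 1.
Proof.
move=> x0 sum_x; pose S k := \sum_(i < n | (i < k)%N) x i; pose fl k := Num.truncn (S k).
have S_ge0 k : 0 <= S k by exact: sumr_ge0.
have S_step (i : 'I_n) : S i.+1 = S i + x i.
  rewrite /S [LHS](bigD1 i) //= addrC; congr (_ + _); apply: eq_bigl => l.
  by rewrite ltnS ltn_neqAle andbC -(inj_eq val_inj).
have fl_le : {homo fl : k l / (k <= l)%N}.
  move=> k l kl; rewrite truncn_ge_nat //; have /andP[Sk_ge _] := truncn_itv (S_ge0 k).
  apply: le_trans Sk_ge _; rewrite /S [leRHS](bigID (fun i : 'I_n => (i < k)%N)) /=.
  rewrite [X in _ <= X + _](eq_bigl (fun i : 'I_n => (i < k)%N)) => [|i].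
    by rewrite lerDl; exact: sumr_ge0.
  by rewrite andb_idl // => /leq_trans; exact.
exists (fun i => fl i.+1 - fl i)%N; split=> [|i].
  rewrite -(big_mkord xpredT (fun i => fl i.+1 - fl i)%N) telescope_sumn //.
  have -> : fl 0%N = 0%N by rewrite /fl /S big_pred0 ?truncn0.
  have -> : fl n = N.
    rewrite /fl /S -[RHS](@natrK R) -sum_x; congr Num.truncn.
    by apply: eq_bigl => i; rewrite ltn_ord.
  exact: subn0.
rewrite natrB ?fl_le //.
have /andP[] := truncn_itv (S_ge0 i); have /andP[] := truncn_itv (S_ge0 i.+1).
by rewrite -/(fl i) -/(fl i.+1) S_step -!natr1 ltr_norml; lra.
Qed.

Lemma connected_cover_connect (T : topologicalType) (I : finType) (D : {set I}) (U : I -> set T)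
    (A : set T) (e : rel I) :
    connected A -> (forall i, open (U i)) -> connect_sym e ->
    (forall x, A x -> exists2 i, i \in D & U i x) ->
    (forall i j x, i \in D -> j \in D -> A x -> U i x -> U j x -> connect e i j) ->
  forall i j x y, i \in D -> j \in D -> A x -> U i x -> A y -> U j y -> connect e i j.
Proof.
move=> A_conn U_open e_sym U_cover U_meet i j x y iD jD Ax Uix Ay Ujy.
pose reached := \bigcup_(k in [set k | k \in D /\ connect e i k]) U k.
pose missed := \bigcup_(k in [set k | k \in D /\ ~ connect e i k]) U k.
have separated z : A z -> reached z -> ~ missed z.
  move=> Az [k [kD ik] Ukz] [l [lD il] Ulz]; apply: il.
  exact: connect_trans ik (U_meet k l z kD lD Az Ukz Ulz).
have covered z : A z -> reached z \/ missed z.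
  move=> Az; have [k kD Ukz] := U_cover z Az.
  by have [ik|ik] := pselect (connect e i k); [left|right]; exists k.
have A_reached : A `&` reached = A.
  apply: A_conn; first by exists x; split=> //; exists i.
  - by exists reached => //; apply: bigcup_open => k _; exact: U_open.
  - exists (~` missed); first by apply: open_closedC; apply: bigcup_open => k _; exact: U_open.
    apply/seteqP; split=> z [Az]; first by move=> /(separated z Az).
    by have [//|] := covered z Az.
have [k [kD ik] Uky] : reached y by have [] : (A `&` reached) y by rewrite A_reached.
exact: connect_trans ik (U_meet k j y kD jD Ay Uky Ujy).
Qed.

Section GridCover.
Variables (R : realType) (n N : nat) (K : {set {set 'I_n}}).
Hypothesis N_gt0 : (0 < N)%N.
Hypothesis K_surface : closed_surface_complex K.
Implicit Types (a b : gpoint n N) (x y : 'rV[R]_n).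

Definition grid_cell a : set 'rV[R]_n :=
  [set x | forall i, `|N%:R * x ord0 i - (coord a i)%:R| < 1].

Lemma grid_cell_open a : open (grid_cell a).
Proof.
rewrite openE => x ax.
suff near_coord i : \forall y \near x, `|N%:R * (y : 'rV[R]_n) ord0 i - (coord a i)%:R| < 1.
  exact: (filter_forall (F := nbhs x)
    (f := fun i (y : 'rV[R]_n) => `|N%:R * y ord0 i - (coord a i)%:R| < 1)) near_coord.
have dist_cvg : (fun z : R => `|N%:R * z - (coord a i)%:R|) @ x ord0 i -->
    `|N%:R * x ord0 i - (coord a i)%:R|.
  apply: cvg_norm; apply: cvgB; last exact: cvg_cst.
  by apply: cvgM; [exact: cvg_cst|exact: cvg_id].
have coord_cvg : (fun y : 'rV[R]_n => `|N%:R * y ord0 i - (coord a i)%:R|) @ x -->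
    `|N%:R * x ord0 i - (coord a i)%:R|.
  exact: cvg_comp (@coord_continuous R 1 n ord0 i x) dist_cvg.
exact: (cvgr_lt _ coord_cvg 1 (ax i)).
Qed.

Lemma grid_cell_dist a x y i : grid_cell a x -> grid_cell a y ->
  `|x ord0 i - y ord0 i| < 2 / N%:R.
Proof.
move=> /(_ i) xa /(_ i) ya; have N_pos : (0 : R) < N%:R by rewrite ltr0n.
rewrite ltr_pdivlMr // -[in X in _ * X](gtr0_norm N_pos) -normrM.
by move: xa ya; rewrite !ltr_norml; lra.
Qed.

Lemma grid_cell_supp a x (s : {set 'I_n}) :
    grid_cell a x -> (forall i, i \notin s -> x ord0 i = 0) ->
  gsupp a \subset s.
Proof.
move=> ax xs; apply/fintype.subsetP => i; rewrite inE; apply: contraTT => /xs xi.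
by have := ax i; rewrite xi mulr0 sub0r normrN normr_nat ltrn1 ltnS -leqNgt.
Qed.

Lemma grid_cell_cover x : polyhedron R K x -> exists2 a, on_grid a & grid_cell a x.
Proof.
case=> x_ge0 sum_x _.
have [||p [sum_p p_near]] := @integer_rounding R n N (fun i => N%:R * x ord0 i).
- by move=> i; rewrite mulr_ge0.
- by rewrite -mulr_sumr sum_x mulr1.
have pE i : coord (gpoint_of N p) i = p i.
  by rewrite coord_gpoint_of // -sum_p (bigD1 i) //= leq_addr.
exists (gpoint_of N p); first by rewrite /on_grid (eq_bigr p) // sum_p.
by move=> i; rewrite pE.
Qed.

Lemma grid_cell_edge a b x : polyhedron R K x -> on_grid a -> on_grid b -> grid_cell a x ->
  grid_cell b x -> a != b -> [set a; b]%SET \in edges_of (grid_complex N K).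
Proof.
case=> _ _ [s sK xs] aN bN ax bx ab.
apply: (grid_edge N_gt0 K_surface sK) => //.
- exact: grid_cell_supp ax xs.
- exact: grid_cell_supp bx xs.
have near_coord (c d : gpoint n N) i : grid_cell c x -> grid_cell d x ->
    (coord c i <= coord d i + 1)%N.
  move=> /(_ i) + /(_ i); rewrite !ltr_norml => cx dx.
  have : (coord c i)%:R < (coord d i + 2)%:R :> R by rewrite natrD; lra.
  by rewrite ltr_nat addn2 ltnS addn1.
by apply/gcloseP => i; split; exact: near_coord.
Qed.

Definition grid_hull (A : set 'rV[R]_n) : {set gpoint n N} :=
  [set a | on_grid a && `[< exists2 x, A x & grid_cell a x >]]%SET.

Lemma grid_hullP A a : reflect (on_grid a /\ exists2 x, A x & grid_cell a x) (a \in grid_hull A).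
Proof.
rewrite inE; apply: (iffP andP) => [[aN /asboolP //]|[aN Aa]].
by split=> //; apply/asboolP.
Qed.

Lemma grid_hull_connected A : A `<=` polyhedron R K -> connected A ->
  connected_in (edges_of (grid_complex N K)) (grid_hull A).
Proof.
move=> A_poly A_conn a b aA bA.
have /grid_hullP[aN [x Ax ax]] := aA; have /grid_hullP[bN [y Ay yb]] := bA.
apply: (connected_cover_connect (D := [set c | on_grid c]%SET) A_conn grid_cell_open
  (@adj_in_sym _ _ _) _ _ _ _ Ax ax Ay yb); rewrite ?inE //.
  by move=> z Az; have [c cN cz] := grid_cell_cover (A_poly _ Az); exists c; rewrite ?inE.
move=> c d z; rewrite !inE => cN dN Az cz dz; have [->|cd] := eqVneq c d; first exact: connect0.
apply: connect1; rewrite /adj_in /= (grid_cell_edge (A_poly _ Az)) // andbT.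
by apply/andP; split; apply/grid_hullP; split=> //; exists z.
Qed.

End GridCover.

Lemma fin_bigcup_compact (T : topologicalType) (I : finType) (P : pred I) (A : I -> set T) :
  (forall i, P i -> compact (A i)) -> compact (\bigcup_(i in [set i | P i]) A i).
Proof.
move=> A_compact; rewrite (_ : [set i | P i] = [set i | (i \in enum I) && P i]).
  by rewrite bigcup_seq_cond; exact: bigsetU_compact.
by apply/seteqP; split=> i; rewrite /= mem_enum.
Qed.

Lemma compact_separated (R : realType) (T : pseudoMetricType R) (A B : set T) :
    hausdorff_space T -> compact A -> compact B -> A `&` B = set0 ->
  \forall e \near (0 : R)^'+, forall x y, A x -> B y -> ~ ball x e y.
Proof.
move=> T_haus A_compact B_compact AB.
have B_closed : closed B by exact: compact_closed.
suff : \forall e \near (0 : R)^'+, A `<=` (fun x => forall y, B y -> ~ ball x e y).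
  by apply: filterS => e sep x y Ax; exact: sep.
have /compact_near_coveringP/(_ R (0^'+)) := A_compact; apply.
move=> x Ax; have : nbhs x (~` B).
  apply: open_nbhs_nbhs; split; first exact: closed_openC.
  by move=> Bx; have : (A `&` B) x by []; rewrite AB.
move=> /nbhs_ballP[r /= r_gt0 rB]; have r2_gt0 : 0 < r / 2 by rewrite divr_gt0.
exists (ball x (r / 2), [set e | e < r / 2]).
  by split=> /=; [exact: nbhsx_ballx|exact: nbhs_right_lt].
move=> [x' e] /= [xx' er] y By x'y; apply: (rB y) => //; rewrite [r]splitr.
by apply: ball_triangle xx' _; apply: le_ball x'y; exact: ltW.
Qed.

Lemma compact_family_separated (R : realType) (T : pseudoMetricType R) (J : finType)
    (A : J -> set T) : hausdorff_space T -> (forall j, compact (A j)) ->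
  exists2 e : R, 0 < e &
    forall i j x y, A i x -> A j y -> ball x e y -> A i `&` A j !=set0.
Proof.
move=> T_haus A_compact.
have sep : \forall e \near (0 : R)^'+, forall ij : J * J,
    forall x y, A ij.1 x -> A ij.2 y -> ball x e y -> A ij.1 `&` A ij.2 !=set0.
  apply: filter_forall => -[i j] /=.
  have [meet|/set0P/negP/negPn/eqP dis] := pselect (A i `&` A j !=set0); first by near=> e.
  apply: filterS (compact_separated T_haus (A_compact i) (A_compact j) dis) => e sep x y Ax Ay xy.
  by have := sep x y Ax Ay.
near (0 : R)^'+ => e; exists e; first by [].
by move=> i j; exact: (near sep e _ (i, j)).
Unshelve. all: by end_near.
Qed.

Lemma grid_hull_separated (R : realType) (n : nat) (J : finType) (A : J -> set 'rV[R]_n) :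
    (forall j, compact (A j)) ->
  exists2 N, (0 < N)%N & forall i j a,
    a \in grid_hull N (A i) -> a \in grid_hull N (A j) -> A i `&` A j !=set0.
Proof.
move=> A_compact.
have [e e_gt0 sep] := compact_family_separated (@norm_hausdorff _ 'rV[R]_n) A_compact.
have e2_gt0 : 0 < e / 2 by rewrite divr_gt0.
have [m m_lt] : exists m : nat, m.+1%:R^-1 < e / 2.
  by have [m _ /(_ m (leqnn m)) m_lt] := near_infty_natSinv_lt (PosNum e2_gt0); exists m.
exists m.+1 => // i j a /grid_hullP[_ [x Ax ax]] /grid_hullP[_ [y Ay ay]].
apply: (sep i j x y Ax Ay); split=> // i0 l; rewrite (ord1 i0) /ball /=.
apply: lt_trans (grid_cell_dist (ltn0Sn m) l ax ay) _; move: _^-1 m_lt => r; lra.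
Qed.

Section EmbeddingMinor.
Variables (R : realType) (n : nat) (K : {set {set 'I_n}}) (G : sgraph).
Hypothesis K_surface : closed_surface_complex K.
Variables (pos : G -> 'rV[R]_n) (arc : edge G -> R -> 'rV[R]_n) (tail head : edge G -> G).
Hypothesis pos_poly : forall v, polyhedron R K (pos v).
Hypothesis arc_poly : forall e t, polyhedron R K (arc e t).
Hypothesis pos_inj : injective pos.
Hypothesis arc_cont : forall e, {within `[0, 1], continuous (arc e)}.
Hypothesis arc_inj : forall e, set_inj `[0, 1] (arc e).
Hypothesis val_tail_head : forall e : edge G, val e = [set tail e; head e]%SET.
Hypothesis arc0 : forall e, arc e 0 = pos (tail e).
Hypothesis arc1 : forall e, arc e 1 = pos (head e).
Hypothesis arc_pos : forall e t v, `]0, 1[%classic t -> arc e t <> pos v.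
Hypothesis arc_arc : forall e f t s, e != f ->
  `]0, 1[%classic t -> `]0, 1[%classic s -> arc e t <> arc f s.
Implicit Types (e f : edge G) (t s : R) (u v w : G).

Lemma tail_neq_head e : tail e != head e.
Proof. by have := edge_set_card (valP e); rewrite val_tail_head cards2; case: eqP. Qed.

Lemma arc_eq_pos e t v : 0 <= t <= 1 -> arc e t = pos v ->
  (t = 0 /\ v = tail e) \/ (t = 1 /\ v = head e).
Proof.
move=> /andP[t0 t1]; have [->|t_neq0] := eqVneq t 0.
  by rewrite arc0 => /pos_inj ->; left.
have [->|t_neq1] := eqVneq t 1; first by rewrite arc1 => /pos_inj ->; right.
by move=> /arc_pos; case; rewrite /= in_itv /= !lt_neqAle t0 t1 t_neq1 eq_sym t_neq0.
Qed.

Lemma arc_meet e f t s : 0 <= t <= 1 -> 0 <= s <= 1 -> arc e t = arc f s ->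
  (e = f /\ t = s) \/ exists v, arc e t = pos v.
Proof.
move=> t01 s01 ets; have [ef|ef] := eqVneq e f.
  by subst f; left; split=> //; apply: (arc_inj _ _ ets); rewrite inE /= in_itv.
right; have interior g r : 0 <= r <= 1 -> `]0, 1[%classic r \/ exists v, arc g r = pos v.
  move=> /andP[r0 r1]; have [->|r_neq0] := eqVneq r 0; first by right; exists (tail g).
  have [->|r_neq1] := eqVneq r 1; first by right; exists (head g).
  by left; rewrite /= in_itv /= !lt_neqAle r0 r1 r_neq1 eq_sym r_neq0.
have [t_int|//] := interior e t t01; have [s_int|[v sv]] := interior f s s01.
  by case: (arc_arc ef t_int s_int).
by exists v; rewrite ets.
Qed.

Definition near_end e v t := (v = tail e /\ t <= 1 / 3) \/ (v = head e /\ 2 / 3 <= t).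

Lemma near_end_inj e v w t : near_end e v t -> near_end e w t -> v = w.
Proof. by case=> -[-> tv] [] [-> tw] //; exfalso; lra. Qed.

Lemma near_end_pos e u v t : 0 <= t <= 1 -> near_end e v t -> arc e t = pos u -> v = u.
Proof.
move=> t01 tv /(arc_eq_pos t01) tu; apply: near_end_inj tv _.
by case: tu => -[-> ->]; [left|right]; split=> //; lra.
Qed.

Lemma pos_near_end e u t : 0 <= t <= 1 -> arc e t = pos u -> near_end e u t.
Proof.
move=> t01 /(arc_eq_pos t01)[] [-> ->]; [left|right]; split=> //; lra.
Qed.

Definition end_third e v : set R :=
  if v == tail e then `[0, 1 / 3]%classic else `[2 / 3, 1]%classic.

(* The point pos v together with the end thirds of the arcs at v. *)
Definition star v : set 'rV[R]_n :=
  \bigcup_(o in [set o | oapp (fun e : edge G => v \in val e) true o])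
    if o is Some e then arc e @` end_third e v else [set pos v].

Definition middle e : set 'rV[R]_n := arc e @` `[1 / 3, 2 / 3]%classic.

Lemma starP v x : star v x <-> x = pos v \/
  exists e t, [/\ 0 <= t <= 1, near_end e v t & x = arc e t].
Proof.
split=> [[[e|] /= ve]|[->|[e [t [t01 tv ->]]]]]; last 2 first.
- by exists None.
- exists (Some e).
    by rewrite /= val_tail_head !inE; case: tv => -[-> _]; rewrite eqxx ?orbT.
  exists t => //; rewrite /end_third; case: tv => -[-> t_le]; rewrite ?eqxx.
    by rewrite /= in_itv /=; lra.
  by rewrite eq_sym (negPf (tail_neq_head e)) /= in_itv /=; lra.
- case=> t t_third <-; right; exists e, t.
  move: ve t_third; rewrite val_tail_head !inE /end_third /near_end.
  case: eqP => [-> _|_ /= /eqP ->]; rewrite /= in_itv /= => t_third.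
    by split; [lra|left; split=> //; lra|].
  by split; [lra|right; split=> //; lra|].
- by left.
Qed.

Lemma star_near_end e v t : 0 <= t <= 1 -> star v (arc e t) -> near_end e v t.
Proof.
move=> t01 /starP[|[f [s [s01 sv ets]]]]; first exact: pos_near_end.
have [[-> -> //]|[u tu]] := arc_meet t01 s01 ets.
have -> : v = u by apply: near_end_pos s01 sv _; rewrite -ets.
exact: pos_near_end.
Qed.

Lemma star_inj v w x : star v x -> star w x -> v = w.
Proof.
move=> /starP[->|[e [t [t01 tv ->]]]]; last by move/(star_near_end t01); exact: near_end_inj.
by move=> /starP[/pos_inj//|[e [t [t01 tw /esym]]]] /(near_end_pos t01 tw) ->.
Qed.

Lemma middle_star e v x : middle e x -> star v x -> v = tail e \/ v = head e.
Proof.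
move=> [t + <-]; rewrite /= in_itv /= => t_mid.
by case/(star_near_end (_ : 0 <= t <= 1)) => [|[->]|[->]]; [lra|left|right].
Qed.

Lemma middle_inj e f x : middle e x -> middle f x -> e = f.
Proof.
move=> [t + <-] [s + /esym ets]; rewrite /= !in_itv /= => t_mid s_mid.
have [t01 s01] : 0 <= t <= 1 /\ 0 <= s <= 1 by split; lra.
have [[]//|[v /(arc_eq_pos t01) t_end]] := arc_meet t01 s01 ets.
by exfalso; case: t_end => -[tE _]; move: t_mid; rewrite tE; lra.
Qed.

Lemma sub_unit_interval (a b : R) : 0 <= a -> b <= 1 -> `[a, b]%classic `<=` `[0, 1]%classic.
Proof. by move=> a0 b1 t; rewrite /= !in_itv /= => /andP[at_ tb]; lra. Qed.

Lemma arc_segment_compact e (a b : R) : 0 <= a -> b <= 1 -> compact (arc e @` `[a, b]%classic).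
Proof.
move=> a0 b1; apply: continuous_compact; last exact: segment_compact.
exact: continuous_subspaceW (sub_unit_interval a0 b1) (@arc_cont e).
Qed.

Lemma arc_segment_connected e (a b : R) :
  0 <= a -> b <= 1 -> connected (arc e @` `[a, b]%classic).
Proof.
move=> a0 b1; apply: connected_continuous_connected; first exact: segment_connected.
exact: continuous_subspaceW (sub_unit_interval a0 b1) (@arc_cont e).
Qed.

Lemma star_compact v : compact (star v).
Proof.
apply: fin_bigcup_compact => -[e|] _; last exact: compact_set1.
by rewrite /end_third; case: eqP => _; apply: arc_segment_compact; lra.
Qed.

Lemma star_connected v : connected (star v).
Proof.
apply: bigcup_connected => [|[e|] _]; last exact: connected1.
  exists (pos v) => -[e|] //=; rewrite val_tail_head !inE /end_third.
  case: eqP => [-> _|_ /eqP ->]; [exists 0 => //|exists 1 => //]; rewrite /= in_itv /=; lra.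
by rewrite /end_third; case: eqP => _; apply: arc_segment_connected; lra.
Qed.

Lemma star_poly v : star v `<=` polyhedron R K.
Proof. by move=> x /starP[->|[e [t [_ _ ->]]]]. Qed.

Lemma middle_poly e : middle e `<=` polyhedron R K.
Proof. by move=> x [t _ <-]. Qed.

Lemma embedding_minor : exists N (beta : gpoint n N -> option G),
  (0 < N)%N /\ minor_model (edges_of (grid_complex N K)) (edge_set G) beta.
Proof.
pose piece j := match j with inl v => star v | inr e => middle e end.
have piece_compact j : compact (piece j).
  by case: j => [v|e]; [exact: star_compact|apply: arc_segment_compact; lra].
have piece_connected j : connected (piece j).
  by case: j => [v|e]; [exact: star_connected|apply: arc_segment_connected; lra].
have piece_poly j : piece j `<=` polyhedron R K.
  by case: j => [v|e]; [exact: star_poly|exact: middle_poly].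
have [N N_gt0 hull_meet] := grid_hull_separated piece_compact.
pose hull j : {set gpoint n N} := grid_hull N (piece j).
have hull_conn j : connected_in (edges_of (grid_complex N K)) (hull j).
  exact: (grid_hull_connected N_gt0 K_surface (@piece_poly j) (@piece_connected j)).
have hull_common i j x : piece i x -> piece j x -> exists2 a, a \in hull i & a \in hull j.
  move=> ix jx; have [a aN ax] := grid_cell_cover N (piece_poly _ _ ix).
  by exists a; apply/grid_hullP; split=> //; exists x.
have middle_end e v t : 1 / 3 <= t <= 2 / 3 -> near_end e v t ->
    exists2 a, a \in hull (inr e) & a \in hull (inl v).
  move=> t_mid tv; apply: (hull_common _ _ (arc e t)); first by exists t.
  by apply/starP; right; exists e, t; split=> //; lra.
exists N, (fun a => [pick v | a \in branch (edges_of (grid_complex N K))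
  (hull \o inl) (hull \o inr) tail head v]); split=> //.
apply: connected_sets_minor => /= [e|v|v w a av aw|e|e|e|e v a ae av|e f a ae af|s sG].
- exact: tail_neq_head.
- exact: hull_conn.
- by have [x [xv xw]] := hull_meet _ _ _ av aw; exact: star_inj xv xw.
- exact: hull_conn.
- by apply: (middle_end _ _ (1 / 3)); [lra|left; split=> //; lra].
- by apply: (middle_end _ _ (2 / 3)); [lra|right; split=> //; lra].
- by have [x [xe xv]] := hull_meet _ _ _ ae av; exact: middle_star xe xv.
- by have [x [xe xf]] := hull_meet _ _ _ ae af; exact: middle_inj xe xf.
- by exists (Sub s sG : edge G); rewrite -val_tail_head SubK.
Qed.

End EmbeddingMinor.

Lemma embedded_edge_set_sparse (R : realType) (G : sgraph) (S : topologicalType) (eps : int)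
    (A : {set {set G}}) : has_euler_char R S eps -> 0 < eps -> embedded_in R G S ->
  A \subset edge_set G -> sparse_edges A.
Proof.
move=> [n [K [K_surface [f [g [[_ g_cont] _ g_poly _ fg]]] chi]]] eps_gt0.
move=> [pos [arc [pos_inj arc_simple arc_ends arc_pos arc_arc]]] AG.
have g_inj : injective g by move=> x y gxy; rewrite -(fg x) // gxy fg.
have {}g_cont : continuous g by apply/continuous_subspace_setT.
have ends e : exists p : G * G,
    [/\ val e = [set p.1; p.2]%SET, arc e 0 = pos p.1 & arc e 1 = pos p.2].
  by have [u [v uv_ends]] := arc_ends e; exists (u, v).
have [ht htP] := fin_all_exists ends.
have [||||||||||N [beta [N_gt0 [branch_conn realized]]]] := @embedding_minor R n K G K_surface
  (g \o pos) (fun e => g \o arc e) (fun e => (ht e).1) (fun e => (ht e).2).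
- by move=> v; exact: g_poly.
- by move=> e t; exact: g_poly.
- exact: inj_comp.
- move=> e x; have [arc_cont _] := arc_simple e.
  exact: (continuous_comp (arc_cont x) (g_cont _)).
- by move=> e t s tI sI /g_inj; have [_ arc_inj] := arc_simple e; exact: arc_inj.
- by move=> e; have [] := htP e.
- by move=> e /=; have [_ ->] := htP e.
- by move=> e /=; have [_ _ ->] := htP e.
- by move=> e t v t01 /g_inj; exact: arc_pos.
- by move=> e e' t t' ee' t01 t'01 /g_inj; exact: arc_arc.
have H1_small : H1_card_le2 (edges_of K) (triangles_of K).
  by apply: surface_H1_card_le2; rewrite ?chi.
apply: (minor_sparse (grid_two_sided N_gt0 K_surface)
    (grid_H1_card_le2 N_gt0 K_surface H1_small)).
  by move=> e eA; apply: edge_set_card; exact: (fintype.subsetP AG).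
by split=> // e /(fintype.subsetP AG); exact: realized.
Qed.

Theorem theorem1p2 (R : realType) (d : nat) (G : sgraph) (S : topologicalType)
    (eps : int) (hd : (2 <= d)%N) (hS : closed_surface R S)
    (hchi : has_euler_char R S eps) (heps : (0 < eps)%R)
    (hG : embedded_in R G S) (hDelta : (5 * d + 2 <= max_degree G)%N) :
  (total_choosability d G <= max_degree G + 2 * d)%N.
Proof.
apply: sparse_total_choosability => // A.
exact: embedded_edge_set_sparse hchi heps hG.
Qed.
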